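(* Let $p>3$ be a prime. Then $$\sum_{k=1}^{(p-1)/2}\frac{\binom{2k}k\binom{4k}{2k}}{k\cdot 64^k}\equiv 6q_p(2)-p\big(3q_p(2)^2+2(-1)^{\frac{p-1}2}E_{p-3}\big)\pmod{p^2},$$ $$\sum_{k=1}^{(p-1)/2}\frac{\binom{2k}k\binom{3k}{k}}{k\cdot 27^k}\equiv 3q_p(3)-p\Big(\frac32q_p(3)^2+2\Big(\frac p3\Big)U_{p-3}\Big)\pmod{p^2},$$ $$\sum_{k=1}^{(p-1)/2}\frac{\binom{3k}k\binom{6k}{3k}}{k\cdot 432^k}\equiv 4q_p(2)+3q_p(3)-p\Big(2q_p(2)^2+\frac32q_p(3)^2+5\Big(\frac p3\Big)U_{p-3}\Big)\pmod{p^2}.$$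
   Context: $q_p(a)=(a^{p-1}-1)/p$ (Fermat quotient). $\big(\frac p3\big)$ is the Legendre symbol ($1$ if $p\equiv1\pmod3$, $-1$ if $p\equiv2\pmod3$). The Euler numbers are defined by $E_0=1$, $E_n=-\sum_{k=1}^{[n/2]}\binom n{2k}E_{n-2k}$ ($n\ge1$). The sequence $U_n$ is defined by $U_0=1$, $U_n=-2\sum_{k=1}^{[n/2]}\binom n{2k}U_{n-2k}$ ($n\ge1$). Congruences are in the ring of rationals with denominators prime to $p$. *)

(* Defs.v *)
From mathcomp Require Import all_boot all_order all_algebra.

Set Implicit Arguments.
Unset Strict Implicit.
Unset Printing Implicit Defensive.

Import GRing.Theory Num.Theory.

Local Open Scope ring_scope.

(* The first n terms of the sequence a_0 = 1,
   a_m = - c * \sum_(1 <= k <= m/2) 'C(m, 2k) a_(m - 2k)  (m >= 1). *)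
Fixpoint even_rec_seq (c : int) (n : nat) : seq int :=
  if n is m.+1 then
    let s := even_rec_seq c m in
    rcons s (if m == 0%N then 1
             else - c * \sum_(1 <= k < (m./2).+1)
                          ('C(m, 2 * k))%:Z * s`_(m - 2 * k))
  else [::].

Definition even_rec (c : int) (n : nat) : int := (even_rec_seq c n.+1)`_n.

Definition euler_number (n : nat) : int := even_rec 1 n.

Definition U_number (n : nat) : int := even_rec 2 n.

Lemma size_even_rec_seq (c : int) (n : nat) : size (even_rec_seq c n) = n.
Proof. by elim: n => //= n IHn; rewrite size_rcons IHn. Qed.

Lemma nth_even_rec_seq (c : int) (n i : nat) :
  (i < n)%N -> (even_rec_seq c n)`_i = even_rec c i.
Proof.
elim: n => // n IHn; rewrite ltnS leq_eqVlt => /predU1P[-> // | ltin].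
by rewrite /= nth_rcons size_even_rec_seq ltin IHn.
Qed.

Lemma even_recS (c : int) (n : nat) : (0 < n)%N ->
  even_rec c n =
  - c * \sum_(1 <= k < (n./2).+1) ('C(n, 2 * k))%:Z * even_rec c (n - 2 * k).
Proof.
move=> n_gt0; rewrite {1}/even_rec /= nth_rcons size_even_rec_seq ltnn eqxx.
rewrite -[n == 0%N]negbK -lt0n n_gt0 /=; congr (_ * _).
apply: eq_big_nat => k /andP[k_gt0 _]; rewrite nth_even_rec_seq //.
by rewrite ltn_subrL muln_gt0 k_gt0 n_gt0.
Qed.

Lemma euler_number0 : euler_number 0 = 1. Proof. by []. Qed.

Lemma euler_numberS (n : nat) : (0 < n)%N ->
  euler_number n =
  - \sum_(1 <= k < (n./2).+1) ('C(n, 2 * k))%:Z * euler_number (n - 2 * k).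
Proof. by move=> n_gt0; rewrite /euler_number even_recS // mulN1r. Qed.

Lemma U_number0 : U_number 0 = 1. Proof. by []. Qed.

Lemma U_numberS (n : nat) : (0 < n)%N ->
  U_number n =
  - 2 * \sum_(1 <= k < (n./2).+1) ('C(n, 2 * k))%:Z * U_number (n - 2 * k).
Proof. exact: even_recS. Qed.

Definition fermat_quotient (p a : nat) : rat := (a%:R ^+ p.-1 - 1) / p%:R.

Definition legendre3 (p : nat) : rat :=
  if (p %% 3 == 1)%N then 1 else if (p %% 3 == 2)%N then -1 else 0.

Definition p_integral (p : nat) (x : rat) : bool := coprime p `|denq x|.

(* Congruence modulo m in the ring of p-integral rationals; x and y are
   themselves required to lie in that ring. *)
Definition p_eqmod (p m : nat) (x y : rat) : Prop :=
  [/\ p_integral p x, p_integral p y &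
      exists2 z : rat, p_integral p z & x - y = m%:R * z].

(* Main.v *)
(* Write 'C(a, k) 'C(-1 - a, k) for the summands, with a = -1/4, -1/3, -1/6.  The
   difference of the truncated sums S(a) = sum_(k <= (p-1)/2) 'C(a, k) 'C(-1 - a, k) / k
   at a and a - 1 telescopes to - (2 / a) (1 - prod_j (1 - a^2 / j^2)).  For
   a = n + p t with 0 <= n < p / 2, iterating it n times down to p t gives
   S(a) = - 2 H_n + 4 p t H_n^(2) modulo p^2, here with n = [p / N] and t = -1/N for
   N = 4, 3, 6.  The combinations H_[p/N] + (p / N) H_[p/N]^(2) are expressed by Fermat
   quotients by taking the p-adic logarithm of the identity expressing N^(p-1) through
   the residues of N i modulo p.  What is left is H_[p/N]^(2) modulo p; it comes from
   the Appell polynomials of the Euler numbers and of the U_n, whose three-term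
   functional equations telescope to alternating sums of the powers i^(p-3) = i^(-2). *)
From HB Require Import structures.
Require Import Defs.
From mathcomp Require Import all_boot all_order all_algebra.
From mathcomp Require Import ring lra zify.

Set Implicit Arguments.
Unset Strict Implicit.
Unset Printing Implicit Defensive.

Import Order.TTheory GRing.Theory Num.Theory.

Local Open Scope ring_scope.

(** * Rationals integral at p and congruences modulo powers of p *)

Definition Zloc (p : nat) := [qualify a x : rat | p_integral p x].

(** Membership may be witnessed by any fraction with denominator prime to $p$, not only the reduced
    one; this makes closure under ring operations immediate. *)
Lemma ZlocP (p : nat) (x : rat) :
  reflect (exists n : int, exists2 d : nat, coprime p d & x * d%:R = n%:~R)
          (x \is a Zloc p).
Proof.
apply: (iffP idP) => [xZ | [n [d cpd xdn]]].
  by exists (numq x), `|denq x|%N => //; rewrite numqE pmulrn absz_denq.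
have: (denq x %| d%:Z)%Z.
  have eq_nd: numq x * d%:Z = n * denq x.
    by apply: (@intr_inj rat); rewrite !rmorphM /= numqE -xdn -pmulrn; ring.
  have: (denq x %| numq x * d%:Z)%Z by rewrite eq_nd dvdz_mull.
  by rewrite Gauss_dvdzr // coprimezE coprime_sym coprime_num_den.
by move=> dvd_d; apply: coprime_dvdr cpd; move: dvd_d; rewrite dvdzE.
Qed.

Lemma Zloc_subring_closed (p : nat) : subring_closed (Zloc p).
Proof.
split=> [|x y|x y].
- by apply/ZlocP; exists 1, 1%N; rewrite ?coprimen1 ?mulr1.
- move=> /ZlocP[n [d cd xn]] /ZlocP[m [e ce ym]]; apply/ZlocP.
  exists (n * e%:Z - m * d%:Z), (d * e)%N; first by rewrite coprimeMr cd.
  by rewrite intrB !intrM -xn -ym natrM -!pmulrn; ring.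
- move=> /ZlocP[n [d cd xn]] /ZlocP[m [e ce ym]]; apply/ZlocP.
  exists (n * m), (d * e)%N; first by rewrite coprimeMr cd.
  by rewrite intrM -xn -ym natrM; ring.
Qed.

HB.instance Definition _ (p : nat) :=
  GRing.isSubringClosed.Build rat (p_integral p) (Zloc_subring_closed p).

Definition p_divisible (p k : nat) (x : rat) : bool := x / p%:R ^+ k \is a Zloc p.

Definition Zpow (p k : nat) := [qualify a x : rat | p_divisible p k x].

Lemma Zpow_zmod_closed (p k : nat) : zmod_closed (Zpow p k).
Proof.
split=> [|x y xP yP]; first by rewrite qualifE /= /p_divisible mul0r rpred0.
by rewrite qualifE /= /p_divisible mulrBl rpredB.
Qed.

HB.instance Definition _ (p k : nat) :=
  GRing.isZmodClosed.Build rat (p_divisible p k) (Zpow_zmod_closed p k).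

(** Only the difference is constrained, so neither side has to be integral; [congr_Zloc] transfers
    integrality from one side to the other. *)
Definition congr_pow (p k : nat) (x y : rat) := x - y \is a Zpow p k.

Notation "x ≡ y [ p ^ k ]" := (congr_pow p k x y)
  (at level 70, y at next level, p at level 2, k at level 9,
   format "x  ≡  y  [ p  ^  k ]") : ring_scope.

Section Congruence.

Variables (p : nat) (p_pr : prime p).
Local Notation P := (p%:R : rat).

Lemma p_neq0 : P != 0.
Proof. by rewrite pnatr_eq0 -lt0n prime_gt0. Qed.

Lemma Zloc_inv (d : nat) : coprime p d -> d%:R^-1 \is a Zloc p.
Proof.
case: d => [|d] cd; first by rewrite invr0 rpred0.
by apply/ZlocP; exists 1, d.+1; rewrite // mulVf // pnatr_eq0.
Qed.

Lemma Zloc_inv_lt (i : nat) : (i < p)%N -> i%:R^-1 \is a Zloc p.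
Proof.
(* The index 0 is allowed because the inverse of 0 is 0 by convention. *)
case: i => [|i] lt_ip; first by rewrite invr0 rpred0.
by apply: Zloc_inv; rewrite prime_coprime // gtnNdvd.
Qed.

Lemma Zpow0 (x : rat) : (x \is a Zpow p 0) = (x \is a Zloc p).
Proof. by rewrite [LHS]qualifE /= /p_divisible expr0 divr1. Qed.

Lemma ZpowM j k (x y : rat) : x \is a Zpow p j -> y \is a Zpow p k ->
  x * y \is a Zpow p (j + k).
Proof.
rewrite ![_ \is a Zpow _ _]qualifE /= /p_divisible => xP yP; have := rpredM xP yP.
by rewrite mulrACA -invfM exprD.
Qed.

Lemma ZpowZ k (x y : rat) : x \is a Zloc p -> y \is a Zpow p k -> x * y \is a Zpow p k.
Proof. by rewrite -Zpow0 => xP yP; apply: (ZpowM xP yP). Qed.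

Lemma ZpowD k x y : x \is a Zpow p k -> y \is a Zpow p k -> x + y \is a Zpow p k.
Proof. exact: rpredD. Qed.

Lemma ZpowB k x y : x \is a Zpow p k -> y \is a Zpow p k -> x - y \is a Zpow p k.
Proof. exact: rpredB. Qed.

Lemma Zpow_exp k : P ^+ k \is a Zpow p k.
Proof. by rewrite qualifE /= /p_divisible divff ?rpred1 // expf_neq0 // p_neq0. Qed.

Lemma ZpowS k (x : rat) : (P * x \is a Zpow p k.+1) = (x \is a Zpow p k).
Proof.
rewrite ![_ \is a Zpow _ _]qualifE /= /p_divisible exprS -mulf_div.
by rewrite divff ?mul1r // p_neq0.
Qed.

Lemma Zpow_le j k (x : rat) : (j <= k)%N -> x \is a Zpow p k -> x \is a Zpow p j.
Proof.
move=> /subnK <-; rewrite ![_ \is a Zpow _ _]qualifE /= /p_divisible exprD => xP.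
suff -> : x / P ^+ j = P ^+ (k - j) * (x / (P ^+ (k - j) * P ^+ j)).
  by rewrite rpredM // rpredX // rpred_nat.
by field; rewrite !expf_neq0 ?p_neq0.
Qed.

Lemma ZpowW k (x : rat) : x \is a Zpow p k -> x \is a Zloc p.
Proof. by rewrite -Zpow0; apply: Zpow_le. Qed.

Lemma Zpow1_nat n : (n%:R \is a Zpow p 1) = (p %| n)%N.
Proof.
apply/idP/idP=> [|/dvdnP[q ->]]; last first.
  by rewrite natrM; apply: ZpowZ (Zpow_exp 1); apply: rpred_nat.
rewrite qualifE /= /p_divisible expr1 => /ZlocP[a [d cpd eq_a]].
have: (p%:Z %| (n * d)%:Z)%Z.
  apply/dvdzP; exists a; apply: (@intr_inj rat).
  by rewrite intrM -eq_a -!pmulrn natrM; field; rewrite p_neq0.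
by rewrite dvdzE /= Gauss_dvdl.
Qed.

(** The ring is local with maximal ideal generated by $p$: a fraction whose numerator is prime to
    $p$ can be inverted. *)
Lemma Zloc_unit x : x \is a Zloc p -> x \isn't a Zpow p 1 ->
  x != 0 /\ x^-1 \is a Zloc p.
Proof.
move=> /ZlocP[n [d cpd eq_n]] x_unit.
have x0 : x != 0 by apply: contraNneq x_unit => ->; rewrite rpred0.
split=> //; have d0 : d%:R != 0 :> rat.
  rewrite pnatr_eq0; apply: contraTneq cpd => ->.
  by rewrite /coprime gcdn0 -[p == 1]negbK neq_ltn prime_gt1 ?orbT.
(* A sign change makes the numerator a natural number, as needed for it to serve as the denominator
   of the inverse. *)
wlog [k eq_k]: x {n eq_n} x_unit x0 / exists k : nat, x * d%:R = k%:R.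
  case: n eq_n => n eq_n wlg; first by apply: (wlg x) => //; exists n.
  rewrite -[x]opprK invrN rpredN; apply: wlg; rewrite ?rpredN ?oppr_eq0 //.
  by exists n.+1; rewrite mulNr eq_n NegzE intrN opprK.
have pNk : ~~ (p %| k)%N.
  apply: contra x_unit => pk; have -> : x = d%:R^-1 * k%:R by rewrite -eq_k; field.
  by apply: ZpowZ; [apply: Zloc_inv | rewrite Zpow1_nat].
by apply/ZlocP; exists d, k; rewrite ?prime_coprime // -eq_k mulKf.
Qed.

(** Provides the inverses of the arguments $i + pt$, which are nonzero modulo $p$. *)
Lemma Zloc_unit_shift i e : (0 < i < p)%N -> e \is a Zpow p 1 ->
  i%:R + e != 0 /\ (i%:R + e)^-1 \is a Zloc p.
Proof.
move=> /andP[i0 ltip] e1; apply: Zloc_unit.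
  by rewrite rpredD ?rpred_nat // (ZpowW e1).
by rewrite -[e]opprK rpredBr ?rpredN // Zpow1_nat gtnNdvd.
Qed.

Lemma Zloc_nat n : n%:R \is a Zloc p. Proof. exact: rpred_nat. Qed.
Lemma Zloc_int (n : int) : n%:~R \is a Zloc p. Proof. exact: rpred_int. Qed.
Lemma Zloc0 : 0 \is a Zloc p. Proof. exact: rpred0. Qed.
Lemma Zloc1 : 1 \is a Zloc p. Proof. exact: rpred1. Qed.
Lemma ZlocN x : x \is a Zloc p -> - x \is a Zloc p. Proof. by rewrite rpredN. Qed.
Lemma ZlocD x y : x \is a Zloc p -> y \is a Zloc p -> x + y \is a Zloc p.
Proof. exact: rpredD. Qed.
Lemma ZlocM (x y : rat) : x \is a Zloc p -> y \is a Zloc p -> x * y \is a Zloc p.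
Proof. exact: rpredM. Qed.
Lemma ZlocX (x : rat) n : x \is a Zloc p -> x ^+ n \is a Zloc p.
Proof. exact: rpredX. Qed.

Lemma congr_refl k x : x ≡ x [p ^ k].
Proof. by rewrite /congr_pow subrr rpred0. Qed.

Lemma congr_eq k x y : x = y -> x ≡ y [p ^ k].
Proof. by move=> ->; apply: congr_refl. Qed.

Lemma congr_sym k x y : x ≡ y [p ^ k] -> y ≡ x [p ^ k].
Proof. by rewrite /congr_pow -opprB rpredN. Qed.

Lemma congr_trans k y x z : x ≡ y [p ^ k] -> y ≡ z [p ^ k] -> x ≡ z [p ^ k].
Proof. by rewrite /congr_pow => xy yz; have := rpredD xy yz; rewrite addrA subrK. Qed.

Lemma congr_sub k x y u v : x ≡ y [p ^ k] -> u - v = x - y -> u ≡ v [p ^ k].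
Proof. by rewrite /congr_pow => ? ->. Qed.

Lemma congrD k x y z t : x ≡ y [p ^ k] -> z ≡ t [p ^ k] -> x + z ≡ y + t [p ^ k].
Proof. by rewrite /congr_pow => xy zt; have := rpredD xy zt; rewrite addrACA -opprD. Qed.

Lemma congrN k x y : x ≡ y [p ^ k] -> - x ≡ - y [p ^ k].
Proof. by rewrite /congr_pow -opprD rpredN. Qed.

Lemma congrB k x y z t : x ≡ y [p ^ k] -> z ≡ t [p ^ k] -> x - z ≡ y - t [p ^ k].
Proof. by move=> xy /congrN; apply: congrD. Qed.

Lemma congrZ k (c x y : rat) : c \is a Zloc p -> x ≡ y [p ^ k] -> c * x ≡ c * y [p ^ k].
Proof. by rewrite /congr_pow -mulrBr => cZ; apply: ZpowZ. Qed.

Lemma congrM k x y z t : x \is a Zloc p -> t \is a Zloc p ->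
  x ≡ y [p ^ k] -> z ≡ t [p ^ k] -> x * z ≡ y * t [p ^ k].
Proof.
move=> xZ tZ xy zt; apply: (@congr_trans _ (x * t)); first exact: congrZ.
by rewrite ![_ * t]mulrC; apply: congrZ.
Qed.

Lemma congrX k (x y : rat) n : x \is a Zloc p -> y \is a Zloc p ->
  x ≡ y [p ^ k] -> x ^+ n ≡ y ^+ n [p ^ k].
Proof.
move=> xZ yZ xy; elim: n => [|n IHn]; first exact: congr_refl.
by rewrite !exprS; apply: congrM => //; apply: rpredX.
Qed.

Lemma congrS k x y : P * x ≡ P * y [p ^ k.+1] <-> x ≡ y [p ^ k].
Proof. by rewrite /congr_pow -mulrBr ZpowS. Qed.

Lemma congr_Zloc k x y : y \is a Zloc p -> x ≡ y [p ^ k] -> x \is a Zloc p.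
Proof. by move=> yZ /ZpowW xy; rewrite -[x](subrK y) rpredD. Qed.

Lemma congr_sum k (I : eqType) (r : seq I) (Q : pred I) (F G : I -> rat) :
  (forall i, i \in r -> Q i -> F i ≡ G i [p ^ k]) ->
  \sum_(i <- r | Q i) F i ≡ \sum_(i <- r | Q i) G i [p ^ k].
Proof.
move=> eqFG; rewrite /congr_pow -sumrB big_seq_cond.
by apply: rpred_sum => i /andP[ir Qi]; apply: eqFG.
Qed.

Lemma congr_sum_nat k (a b : nat) (F G : nat -> rat) :
  (forall i, (a <= i < b)%N -> F i ≡ G i [p ^ k]) ->
  \sum_(a <= i < b) F i ≡ \sum_(a <= i < b) G i [p ^ k].
Proof. by move=> eqFG; apply: congr_sum => i; rewrite mem_index_iota => /eqFG. Qed.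

Lemma congrZK k (c x y : rat) : c != 0 -> c^-1 \is a Zloc p ->
  c * x ≡ c * y [p ^ k] -> x ≡ y [p ^ k].
Proof. by move=> c0 cZ /(congrZ cZ); rewrite !mulKf. Qed.

Lemma congr_inv i : (0 < i < p)%N -> (p - i)%N%:R^-1 ≡ - i%:R^-1 [p ^ 1].
Proof.
move=> /andP[i0 ip]; rewrite /congr_pow.
have -> : (p - i)%N%:R^-1 - - i%:R^-1 = (p - i)%N%:R^-1 * (i%:R^-1 * P) :> rat.
  have iP: (p - i)%N%:R = P - i%:R :> rat by rewrite natrB // ltnW.
  have: (p - i)%N%:R != 0 :> rat by rewrite pnatr_eq0 -lt0n subn_gt0.
  rewrite iP => pi0; have i0': i%:R != 0 :> rat by rewrite pnatr_eq0 -lt0n.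
  by field; rewrite pi0 i0'.
by rewrite !(ZpowZ, Zpow_exp 1) // Zloc_inv_lt // ltn_subrL i0 prime_gt0.
Qed.

End Congruence.

(** Proves integrality by descending through ring operations; integrality of the inverses that occur
    must be available as hypotheses. *)
Ltac zloc := lazymatch goal with
  | |- is_true (in_mem 0 _) => exact: Zloc0
  | |- is_true (in_mem 1 _) => exact: Zloc1
  | |- is_true (in_mem _%:R _) => exact: Zloc_nat
  | |- is_true (in_mem _%:~R _) => exact: Zloc_int
  | |- is_true (in_mem (- _) _) => apply: ZlocN; zloc
  | |- is_true (in_mem (_ + _) _) => apply: ZlocD; zloc
  | |- is_true (in_mem (_ * _) _) => apply: ZlocM; zloc
  | |- is_true (in_mem (_ ^+ _) _) => apply: ZlocX; zloc
  | _ => try assumption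
  end.

(** * Harmonic sums of orders one and two modulo powers of p *)

Definition harmonic (n : nat) : rat := \sum_(1 <= i < n.+1) i%:R^-1.
Definition harmonic2 (n : nat) : rat := \sum_(1 <= i < n.+1) i%:R ^- 2.

Lemma harmonic0 : harmonic 0 = 0.
Proof. by rewrite /harmonic big_geq. Qed.

Lemma harmonicS n : harmonic n.+1 = harmonic n + n.+1%:R^-1.
Proof. by rewrite /harmonic big_nat_recr. Qed.

Lemma harmonic20 : harmonic2 0 = 0.
Proof. by rewrite /harmonic2 big_geq. Qed.

Lemma harmonic2S n : harmonic2 n.+1 = harmonic2 n + n.+1%:R ^- 2.
Proof. by rewrite /harmonic2 big_nat_recr. Qed.

(** Twice the even-indexed part minus the whole sum, the even-indexed part being
    $H^{(2)}_{[n/2]}/4$. *)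
Lemma alternating_harmonic2 n :
  \sum_(1 <= i < n.+1) (-1) ^+ i * i%:R ^- 2 = harmonic2 n./2 / 2 - harmonic2 n.
Proof.
elim: n => [|n IHn]; first by rewrite big_geq // harmonic20 mul0r subrr.
rewrite big_nat_recr //= IHn uphalf_half harmonic2S -signr_odd oddS.
case: (boolP (odd n)) => /= [n_odd|_]; last by rewrite add0n; ring.
rewrite add1n harmonic2S.
have -> : n.+1%:R = 2 * (n./2).+1%:R :> rat.
  by rewrite -natrM; congr _%:R; rewrite -[in LHS](odd_double_half n) n_odd; lia.
by field; rewrite addrC natr1 pnatr_eq0.
Qed.

Lemma odd_prime_gt3 p : prime p -> (3 < p)%N -> odd p.
Proof. by move=> p_pr; case: (even_prime p_pr) => [->|]. Qed.

Lemma prime_gt3_mod3 p : prime p -> (3 < p)%N -> (p %% 3 != 0)%N.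
Proof. by move=> p_pr p_gt3; apply/negP => p3; have := prime_nt_dvdP p_pr _ p3; lia. Qed.

Section HarmonicCongruences.

Variables (p : nat) (p_pr : prime p) (p_gt3 : (3 < p)%N).
Local Notation P := (p%:R : rat).

Let p_odd : odd p. Proof. exact: odd_prime_gt3. Qed.

Lemma congr_inv2 i : (0 < i < p)%N -> (p - i)%N%:R ^- 2 ≡ i%:R ^- 2 [p ^ 1].
Proof.
move=> i_bnd; have /andP[i0 ltip] := i_bnd.
have eqi := congr_inv p_pr i_bnd.
rewrite -!exprVn -[i%:R^-1]opprK sqrrN; apply: congrM => //.
  by rewrite Zloc_inv_lt // ltn_subrL i0 prime_gt0.
by rewrite rpredN Zloc_inv_lt.
Qed.

(* Both sides are four times the sum of 1/i^2 over the odd i <= n, the second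
   one being obtained from the substitution i -> p - i. *)
Lemma harmonic2_odd_part n : (n < p)%N ->
  4 * harmonic2 n - harmonic2 n./2
  ≡ harmonic2 (p.-1)./2 - harmonic2 (p.-1 - n)./2 [p ^ 1].
Proof.
elim: n => [|n IHn] ltnp.
  by apply: congr_eq; rewrite subn0 harmonic20 mulr0 !subrr.
have /IHn {}IHn : (n < p)%N by apply: ltnW.
rewrite /= uphalf_half; case: (boolP (odd n)) => [n_odd|n_even] /=.
  have -> : ((p.-1 - n.+1)./2 = (p.-1 - n)./2)%N by lia.
  apply: congr_trans IHn; apply: congr_eq; rewrite add1n !harmonic2S.
  have -> : n.+1%:R = 2 * (n./2).+1%:R :> rat.
    by rewrite -natrM; congr _%:R; lia.
  by field; rewrite addrC natr1 pnatr_eq0.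
rewrite add0n; set h := ((p.-1 - n.+1)./2)%N in IHn *.
have eq_h : ((p.-1 - n)./2 = h.+1)%N by rewrite /h; lia.
have hE : (h.+1 * 2 = p - n.+1)%N by rewrite /h; lia.
rewrite !harmonic2S eq_h harmonic2S in IHn *.
(* Here $n+1$ is odd, so $p-(n+1)$ is even with half [h.+1], exactly the term that leaves the sum on
   the right. *)
have step : 4 * n.+1%:R ^- 2 ≡ h.+1%:R ^- 2 [p ^ 1].
  have -> : h.+1%:R ^- 2 = 4 * (p - n.+1)%N%:R ^- 2 :> rat.
    by rewrite -hE natrM; field; rewrite addrC natr1 pnatr_eq0.
  by apply: congrZ (congr_sym (congr_inv2 _)); rewrite ?rpred_nat.
by apply: (congr_sub (congrD IHn step)); ring.
Qed.

(** At $n=(p-1)/2$ the same term $H^{(2)}_{[n/2]}$ occurs on both sides of [harmonic2_odd_part];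
    what remains is $3H^{(2)}_n\equiv0$. *)
Lemma harmonic2_half : harmonic2 (p.-1)./2 ≡ 0 [p ^ 1].
Proof.
have ltmp : ((p.-1)./2 < p)%N by lia.
have := harmonic2_odd_part ltmp.
have -> : (p.-1 - p.-1./2 = p.-1./2)%N by lia.
move=> odd_part; apply: (@congrZK _ _ 3%:R) => //.
  by rewrite Zloc_inv_lt.
by apply: (congr_sub odd_part); ring.
Qed.

Lemma harmonic2_full : harmonic2 p.-1 ≡ 0 [p ^ 1].
Proof.
have ltmp : (p.-1 < p)%N by lia.
have := harmonic2_odd_part ltmp; rewrite subnn harmonic20 => odd_part.
apply: (@congrZK _ _ 4%:R) => //; first by rewrite Zloc_inv // (@coprimeXr 2 p 2) // coprimen2.
by apply: (congr_sub (congrD odd_part (congrZ (rpred_nat _ 2) harmonic2_half))); ring.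
Qed.

(** This is [harmonic2_odd_part] at $n=[p/3]$, where $[n/2]=[p/6]$ and $[(p-1-n)/2]=[p/3]$. *)
Lemma harmonic2_sixth : harmonic2 (p %/ 6) ≡ 5 * harmonic2 (p %/ 3) [p ^ 1].
Proof.
have p3 := prime_gt3_mod3 p_pr p_gt3.
have lt3p : (p %/ 3 < p)%N by lia.
have := harmonic2_odd_part lt3p.
have -> : ((p %/ 3)./2 = p %/ 6)%N by lia.
have -> : ((p.-1 - p %/ 3)./2 = p %/ 3)%N by lia.
by move=> odd_part; apply: (congr_sub (congrN (congrD harmonic2_half odd_part))); ring.
Qed.

Lemma congr_inv_sq i : (0 < i < p)%N ->
  (p - i)%N%:R^-1 ≡ - (i%:R^-1 + P * i%:R ^- 2) [p ^ 2].
Proof.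
move=> /andP[i0 ltip]; rewrite /congr_pow.
have -> : (p - i)%N%:R^-1 - - (i%:R^-1 + P * i%:R ^- 2)
    = (p - i)%N%:R^-1 * (i%:R ^- 2 * P ^+ 2) :> rat.
  have iP: (p - i)%N%:R = P - i%:R :> rat by rewrite natrB // ltnW.
  have: (p - i)%N%:R != 0 :> rat by rewrite pnatr_eq0 -lt0n subn_gt0.
  rewrite iP => pi0; have i0': i%:R != 0 :> rat by rewrite pnatr_eq0 -lt0n.
  by field; rewrite pi0 i0'.
apply: ZpowZ; first by rewrite Zloc_inv_lt // ltn_subrL i0 prime_gt0.
apply: ZpowZ; first by rewrite -exprVn rpredX // Zloc_inv_lt.
exact: Zpow_exp.
Qed.

(** The top $n$ terms are $1/(p-i)$ with $1\le i\le n$, each expanded to first order in $p$. *)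
Lemma harmonic_reflect n : (n < p)%N ->
  harmonic p.-1 - harmonic (p.-1 - n) ≡ - (harmonic n + P * harmonic2 n) [p ^ 2].
Proof.
elim: n => [|n IHn] ltnp.
  by rewrite subn0 harmonic0 harmonic20; apply: congr_eq; ring.
have eq_h : (p.-1 - n = (p.-1 - n.+1).+1)%N by lia.
have eq_p : ((p.-1 - n.+1).+1 = p - n.+1)%N by lia.
have := IHn (ltnW ltnp); rewrite eq_h !harmonicS harmonic2S eq_p => IH.
have := congrD IH (@congr_inv_sq n.+1 ltnp).
by rewrite /congr_pow; congr (_ \is a _); ring.
Qed.

Lemma harmonic2_reflect n : (n < p)%N ->
  harmonic2 (p.-1 - n) ≡ - harmonic2 n [p ^ 1].
Proof.
elim: n => [|n IHn] ltnp.
  by rewrite subn0 harmonic20 oppr0 harmonic2_full.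
have eq_h : (p.-1 - n = (p.-1 - n.+1).+1)%N by lia.
have eq_p : ((p.-1 - n.+1).+1 = p - n.+1)%N by lia.
have := IHn (ltnW ltnp); rewrite eq_h !harmonic2S eq_p => IH.
have := congrB IH (@congr_inv2 n.+1 ltnp).
by rewrite /congr_pow; congr (_ \is a _); ring.
Qed.

(** Wolstenholme's congruence: reflecting all $p-1$ terms returns the sum with the opposite sign, up
    to $pH^{(2)}_{p-1}\equiv0$. *)
Lemma harmonic_full : harmonic p.-1 ≡ 0 [p ^ 2].
Proof.
have ltmp : (p.-1 < p)%N by lia.
have := harmonic_reflect ltmp; rewrite subnn harmonic0 => refl.
have full : P * harmonic2 p.-1 ≡ P * 0 [p ^ 2] by apply/congrS/harmonic2_full.
apply: (@congrZK _ _ 2%:R) => //; first by rewrite Zloc_inv_lt // ltnW.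
by apply: (congr_sub (congrB refl full)); ring.
Qed.

End HarmonicCongruences.

(** * Telescoping of the binomial sums in the argument a *)

(* The product 'C(a, k) 'C(-1 - a, k) of generalized binomial coefficients. *)
Definition binprod (a : rat) (k : nat) : rat :=
  \prod_(0 <= j < k) (- (a + j.+1%:R) * (a - j%:R) / j.+1%:R ^+ 2).

(** A truncation of Euler's product for $\sin(\pi a)/(\pi a)$. *)
Definition sineprod (m : nat) (a : rat) : rat :=
  \prod_(1 <= j < m.+1) (1 - a ^+ 2 / j%:R ^+ 2).

Definition binsum (m : nat) (a : rat) : rat :=
  \sum_(1 <= k < m.+1) binprod a k / k%:R.

Lemma sineprod0 a : sineprod 0 a = 1.
Proof. by rewrite /sineprod big_geq. Qed.

Lemma sineprodS m a : sineprod m.+1 a = sineprod m a * (1 - a ^+ 2 / m.+1%:R ^+ 2).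
Proof. by rewrite /sineprod big_nat_recr. Qed.

Lemma binprodS a k :
  binprod a k.+1 = binprod a k * (- (a + k.+1%:R) * (a - k%:R) / k.+1%:R ^+ 2).
Proof. by rewrite /binprod big_nat_recr. Qed.

Lemma binprod1 a : binprod a 1 = - (a + 1) * a.
Proof. by rewrite /binprod big_nat1 subr0 expr1n divr1. Qed.

Lemma binsum0 a : binsum 0 a = 0.
Proof. by rewrite /binsum big_geq. Qed.

Lemma binsumS m a : binsum m.+1 a = binsum m a + binprod a m.+1 / m.+1%:R.
Proof. by rewrite /binsum big_nat_recr. Qed.

(** The numerator factors $a-j$ and $a+j$ with $1\le j\le m$ pair off; only $a$ and $a+m+1$ stay
    single. *)
Lemma binprod_sineprod a m :
  binprod a m.+1 = - a * (a + m.+1%:R) / m.+1%:R ^+ 2 * sineprod m a.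
Proof.
elim: m => [|m IHm]; first by rewrite binprod1 sineprod0 expr1n; field.
have s0 : m.+1%:R != 0 :> rat by rewrite pnatr_eq0.
have s1 : m.+1%:R + 1 != 0 :> rat by rewrite natr1 pnatr_eq0.
rewrite binprodS IHm sineprodS -[m.+2%:R]natr1.
by move: (m.+1%:R) s0 s1 => s s0 s1; field; rewrite s0 s1.
Qed.

(** At $a-1$ the same pairs occur, and now $a$ and $a-m-1$ stay single; hence both products are
    multiples of the same [sineprod m a]. *)
Lemma binprod_sub1_sineprod a m :
  binprod (a - 1) m.+1 = - a * (a - m.+1%:R) / m.+1%:R ^+ 2 * sineprod m a.
Proof.
elim: m => [|m IHm]; first by rewrite binprod1 sineprod0 expr1n; field.
have s0 : m.+1%:R != 0 :> rat by rewrite pnatr_eq0.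
have s1 : m.+1%:R + 1 != 0 :> rat by rewrite natr1 pnatr_eq0.
rewrite binprodS IHm sineprodS -[m.+2%:R]natr1.
by move: (m.+1%:R) s0 s1 => s s0 s1; field; rewrite s0 s1.
Qed.

(* The terms of the difference telescope, since
   'sineprod j a - sineprod j.+1 a = sineprod j a * a ^ 2 / j.+1 ^ 2'. *)
Lemma binsum_step m a : a != 0 ->
  binsum m a - binsum m (a - 1) = - (2 / a) * (1 - sineprod m a).
Proof.
move=> a0; elim: m => [|m IHm]; first by rewrite !binsum0 sineprod0; ring.
rewrite !binsumS binprod_sineprod binprod_sub1_sineprod sineprodS.
have s0 : m.+1%:R != 0 :> rat by rewrite pnatr_eq0.
have -> : binsum m a = - (2 / a) * (1 - sineprod m a) + binsum m (a - 1).
  by rewrite -IHm subrK.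
by move: (m.+1%:R) s0 => s s0; field; rewrite a0 s0.
Qed.

(** Compares the two expressions of [binprod (a - 1) m.+1], through $a$ and through $a-1$. *)
Lemma sineprod_shift a m :
  a * (a - m.+1%:R) * sineprod m a = (a - 1) * (a + m%:R) * sineprod m (a - 1).
Proof.
have s0 : m.+1%:R != 0 :> rat by rewrite pnatr_eq0.
have := binprod_sineprod (a - 1) m; rewrite binprod_sub1_sineprod => eq_bp.
apply: (@mulfI _ (- m.+1%:R ^- 2)); first by rewrite oppr_eq0 invr_eq0 expf_neq0.
transitivity (- a * (a - m.+1%:R) / m.+1%:R ^+ 2 * sineprod m a); first ring.
by rewrite eq_bp -natr1; ring.
Qed.

(** * The truncated sum at n + p t modulo the square of p *)

Section TruncatedSum.

Variables (p : nat) (p_pr : prime p) (p_gt3 : (3 < p)%N).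
Variables (t : rat) (t_int : t \is a Zloc p).
Local Notation P := (p%:R : rat).
Local Notation m := (p.-1)./2.

Let p_odd : odd p. Proof. exact: odd_prime_gt3. Qed.

Let Pt_int : P * t \is a Zloc p.
Proof. by rewrite rpredM // rpred_nat. Qed.

Let Pt_div : P * t \is a Zpow p 1.
Proof. by rewrite mulrC ZpowZ // (Zpow_exp p_pr 1). Qed.

Let invi_int i : (i < p)%N -> i%:R ^- 2 \is a Zloc p.
Proof. by move=> ltip; rewrite -exprVn rpredX // Zloc_inv_lt. Qed.

Lemma sineprod_mult_p n : (n <= m)%N -> sineprod n (P * t) ≡ 1 [p ^ 2].
Proof.
elim: n => [|n IHn] lenm; first by rewrite sineprod0 congr_refl.
have ltnp : (n.+1 < p)%N by lia.
have {}IHn := IHn (ltnW lenm).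
have step : (P * t) ^+ 2 / n.+1%:R ^+ 2 * sineprod n (P * t) ≡ 0 [p ^ 2].
  rewrite /congr_pow subr0 mulrC ZpowZ //; first by rewrite (congr_Zloc p_pr _ IHn) ?rpred1.
  by rewrite mulrC ZpowZ ?invi_int // expr2 (ZpowM Pt_div Pt_div).
apply: congr_sub (congrB IHn step) _.
by rewrite sineprodS; ring.
Qed.

(** Modulo $p^2$ the summand at $pt$ is $-pt/k^2$, and $H^{(2)}_{(p-1)/2}$ vanishes modulo $p$. *)
Lemma binsum_mult_p : binsum m (P * t) ≡ 0 [p ^ 2].
Proof.
suff: binsum m (P * t) ≡ - t * (P * harmonic2 m) [p ^ 2].
  move/congr_trans; apply; rewrite -[X in _ ≡ X [_ ^ _]](mulr0 (- t)).
  apply: congrZ; first by rewrite rpredN.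
  by rewrite -[X in _ ≡ X [_ ^ _]](mulr0 P); apply/congrS/harmonic2_half.
rewrite /binsum /harmonic2 !mulr_sumr; apply: congr_sum_nat => -[//|k] /andP[_ ltk].
have ltkp : (k.+1 < p)%N by lia.
have k0 : k.+1%:R != 0 :> rat by rewrite pnatr_eq0.
have k_int : k.+1%:R^-1 \is a Zloc p by apply: Zloc_inv_lt.
have D1 := sineprod_mult_p (ltnW ltk).
have D_int : sineprod k (P * t) \is a Zloc p by rewrite (congr_Zloc p_pr _ D1) ?rpred1.
rewrite binprod_sineprod /congr_pow.
set D := sineprod _ _ in D1 D_int *.
have -> : - (P * t) * (P * t + k.+1%:R) / k.+1%:R ^+ 2 * D / k.+1%:R
    - - t * (P * k.+1%:R ^- 2)
    = - (D * k.+1%:R ^- 2 * k.+1%:R^-1 * ((P * t) * (P * t))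
         + (P * t) * k.+1%:R ^- 2 * (D - 1)) :> rat.
  by move: (k.+1%:R) k0 => s s0; field.
rewrite rpredN rpredD // ZpowZ ?(ZpowM Pt_div Pt_div) ?rpredM ?invi_int //.
exact: Zloc_nat.
Qed.

(** Since $2m+1=p$, the factors $a+m$ and $a-m-1$ in [sineprod_shift] differ by $p$. The quantity is
    itself divisible by $p$, so replacing $a-1$ by $a$ does not change it modulo $p^2$. *)
Lemma sineprod_congr i : (i <= m)%N ->
  (i%:R + P * t) * sineprod m (i%:R + P * t) ≡ P * t [p ^ 2].
Proof.
elim: i => [|i IHi] ltim.
  rewrite add0r -[X in _ ≡ X [_ ^ _]]mulr1; apply: congrZ => //.
  exact: sineprod_mult_p.
have {}IHi := IHi (ltnW ltim); apply: (congr_trans _ IHi).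
have := sineprod_shift (i.+1%:R + P * t) m.
have -> : i.+1%:R + P * t - 1 = i%:R + P * t by rewrite -natr1; ring.
set Y := _ * sineprod _ (i%:R + _) in IHi *; set X := _ * sineprod _ (i.+1%:R + _).
set u := i.+1%:R + P * t - (m.+1)%:R => shift.
(* Here [u] equals $pt-(m-i)$ with $0<m-i<p$, hence is a unit. *)
have [u0 u_int] : u != 0 /\ u^-1 \is a Zloc p.
  have bnd : (0 < m - i < p)%N by lia.
  have [] := Zloc_unit_shift p_pr bnd (_ : - (P * t) \is a Zpow p 1).
    by rewrite rpredN.
  have -> : (m - i)%N%:R + - (P * t) = - u.
    by rewrite natrB ?(ltnW ltim) // /u -!natr1; ring.
  by rewrite oppr_eq0 invrN rpredN.
have eq_X : X = Y + P * Y * u^-1.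
  apply: (mulIf u0); transitivity (Y * (i.+1%:R + P * t + m%:R)).
    by apply: etrans (etrans _ shift) _; rewrite /X /Y /u; ring.
  have -> : i.+1%:R + P * t + m%:R = u + P.
    rewrite /u (_ : P = (m.*2.+1)%:R); last by congr _%:R; lia.
    by rewrite -muln2 -!natr1 natrM; ring.
  by field.
have Y1 : Y \is a Zpow p 1.
  by rewrite -[Y](subrK (P * t)) rpredD // (Zpow_le p_pr _ IHi).
rewrite /congr_pow; have -> : X - Y = u^-1 * (Y * P ^+ 1) by rewrite eq_X; ring.
exact: ZpowZ u_int (ZpowM Y1 (Zpow_exp p_pr 1)).
Qed.

(** For $a=n+1+pt$ the step from $a-1$ to $a$ adds $-2/a+2pt/a^2$ by [binsum_step] and
    [sineprod_congr], which expands to $-2/(n+1)+4pt/(n+1)^2$. *)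
Lemma binsum_congr n : (n <= m)%N ->
  binsum m (n%:R + P * t) ≡ - 2 * harmonic n + 4 * (P * t * harmonic2 n) [p ^ 2].
Proof.
elim: n => [|n IHn] ltnm.
  by rewrite add0r harmonic0 harmonic20 !mulr0 addr0 binsum_mult_p.
have {IHn} IHn := IHn (ltnW ltnm).
have bnd : (0 < n.+1 < p)%N by lia.
have [a0 a_int] := Zloc_unit_shift p_pr bnd Pt_div.
have sp := sineprod_congr ltnm.
have := binsum_step m a0.
have -> : n.+1%:R + P * t - 1 = n%:R + P * t by rewrite -natr1; ring.
move/(canRL (subrK _)) => ->; rewrite harmonicS harmonic2S.
have s0 : n.+1%:R != 0 :> rat by rewrite pnatr_eq0.
have s_int : n.+1%:R^-1 \is a Zloc p by apply: Zloc_inv_lt => //; lia.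
rewrite /congr_pow.
set D := sineprod _ _ in sp *; set a := _ + P * t in a0 a_int sp *.
set B := binsum _ _ in IHn *; have Pt2 := ZpowM Pt_div Pt_div.
(* The error is split exactly into the induction error, a multiple of [a * D - P * t], and a
   multiple of $(pt)^2$. *)
have -> : - (2 / a) * (1 - D) + B
      - (- 2 * (harmonic n + n.+1%:R^-1) + 4 * (P * t * (harmonic2 n + n.+1%:R ^- 2)))
    = (B - (- 2 * harmonic n + 4 * (P * t * harmonic2 n)))
      + (2 * a^-1 ^+ 2 * (a * D - P * t)
         - 2 * (a^-1 * n.+1%:R^-1 ^+ 2 + (n.+1%:R + a) * a^-1 ^+ 2 * n.+1%:R^-1 ^+ 2)
           * (P * t * (P * t))).
  have -> : P * t = a - n.+1%:R by rewrite addrAC subrr add0r.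
  by move: (n.+1%:R) s0 => s s0; field; rewrite a0 s0.
have a_loc : a \is a Zloc p by rewrite /a; zloc.
apply: ZpowD; first exact: IHn.
apply: ZpowB.
  by apply: (ZpowZ _ sp); zloc.
by apply: (ZpowZ _ Pt2); zloc.
Qed.

End TruncatedSum.

(** * Fermat quotients through the p-adic logarithm *)

(** Writes $f$ and $f^2=\sum_{j\le f}(2j-1)$ as sums over thresholds $j\le f$, so that a floor $f$
    can be removed by exchanging summations. *)
Lemma sum_leq_linear (N f : nat) (A B : rat) : (f < N)%N ->
  \sum_(1 <= j < N | (j <= f)%N) (A + (j%:R *+ 2 - 1) * B) = f%:R * A + f%:R ^+ 2 * B.
Proof.
move=> ltfN; rewrite -(big_nat_widen 1 f.+1 N predT) //=.
elim: f {ltfN} => [|f IHf]; first by rewrite big_geq //; ring.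
by rewrite big_nat_recr //= IHf -natr1; ring.
Qed.

(** Multiplication by $N$ is injective on the nonzero residues, hence permutes them. *)
Lemma prod_modn_coprime (p N : nat) : prime p -> coprime p N ->
  (\prod_(1 <= i < p) ((N * i) %% p) = \prod_(1 <= i < p) i)%N.
Proof.
move=> p_pr cpN; have p_gt0 := prime_gt0 p_pr.
rewrite -(big_map (fun i => (N * i) %% p)%N predT id).
apply: perm_big; set s := map _ _.
have s_uniq : uniq s.
  rewrite map_inj_in_uniq ?iota_uniq // => i j.
  rewrite !mem_index_iota => /andP[_ ltip] /andP[_ ltjp].
  wlog leij: i j ltip ltjp / (i <= j)%N.
    move=> wlg eq_ij; case/orP: (leq_total i j) => le; first exact: wlg.
    by symmetry; apply: wlg.
  move/eqP; rewrite eq_sym eqn_mod_dvd ?leq_mul2l ?leij ?orbT // -mulnBr Gauss_dvdr //.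
  by case: (posnP (j - i)) => [|ji_gt0 /(dvdn_leq ji_gt0)]; lia.
apply: uniq_perm; rewrite ?iota_uniq //.
apply: (uniq_min_size s_uniq _ _).2; last by rewrite size_map.
move=> _ /mapP[i + ->]; rewrite !mem_index_iota => /andP[i_gt0 ltip].
by rewrite ltn_mod p_gt0 andbT lt0n -/(dvdn p _) Gauss_dvdr // gtnNdvd.
Qed.

Section FermatQuotient.

Variables (p : nat) (p_pr : prime p) (p_gt3 : (3 < p)%N).
Local Notation P := (p%:R : rat).
Local Notation m := (p.-1)./2.

Let p_odd : odd p. Proof. exact: odd_prime_gt3. Qed.

Let two_int : 2^-1 \is a Zloc p.
Proof. by rewrite Zloc_inv_lt // ltnW. Qed.

(* Modulo p^2, this is the p-adic logarithm of 1 + p x divided by p. *)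
Definition plog (x : rat) : rat := x - P * x ^+ 2 / 2.

Lemma fermat_quotientE (a : nat) : 1 + P * fermat_quotient p a = a%:R ^+ p.-1.
Proof. by rewrite /fermat_quotient; field; rewrite (p_neq0 p_pr). Qed.

Lemma Zloc_fermat_quotient (a : nat) : coprime p a -> fermat_quotient p a \is a Zloc p.
Proof.
move=> cpa; rewrite -Zpow0 -(ZpowS p_pr).
have -> : P * fermat_quotient p a = a%:R ^+ p.-1 - 1 by rewrite -fermat_quotientE; ring.
have a_gt0 : (0 < a)%N by case: a cpa => //; rewrite /coprime gcdn0 => /eqP p1; lia.
rewrite -natrX -[X in _ - X]/(1%:R) -natrB ?expn_gt0 ?a_gt0 // (Zpow1_nat p_pr).
rewrite -(@Gauss_dvdr p a) // mulnBr muln1 -expnS prednK ?prime_gt0 //.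
rewrite -eqn_mod_dvd ?(fermat_little _ p_pr) //.
by rewrite -{1}(expn1 a) leq_pexp2l // prime_gt0.
Qed.

Lemma plog0 : plog 0 = 0. Proof. by rewrite /plog; ring. Qed.

(** The cross term $pxy$ of $z$ is cancelled by the quadratic term of [plog]; the rest is an
    explicit multiple of $p^2$. *)
Lemma plogM x y z : x \is a Zloc p -> y \is a Zloc p ->
  1 + P * z = (1 + P * x) * (1 + P * y) -> plog z ≡ plog x + plog y [p ^ 2].
Proof.
move=> x_int y_int eq_z.
have {eq_z} -> : z = x + y + P * x * y.
  by apply: (mulfI (p_neq0 p_pr)); apply: (addrI 1); rewrite eq_z; ring.
rewrite /congr_pow /plog.
set lhs := (X in X \is a _).
have -> : lhs = (- (x * y * (x + y)) - P * (x ^+ 2 * y ^+ 2) * 2^-1) * P ^+ 2.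
  by rewrite /lhs; field.
by apply: ZpowZ (Zpow_exp p_pr 2); zloc.
Qed.

(** The product is returned in the form $1+pu$ because [plog] takes $u$, not $1+pu$, as its
    argument. *)
Lemma plog_prod (x : nat -> rat) n : (forall i, (0 < i <= n)%N -> x i \is a Zloc p) ->
  exists u : rat, [/\ u \is a Zloc p, 1 + P * u = \prod_(1 <= i < n.+1) (1 + P * x i)
    & plog u ≡ \sum_(1 <= i < n.+1) plog (x i) [p ^ 2]].
Proof.
elim: n => [|n IHn] x_int.
  exists 0; split; rewrite ?rpred0 ?big_geq //; first by rewrite mulr0 addr0.
  by apply: congr_eq; rewrite /plog; ring.
case: IHn => [i /andP[i0 lein]|u [u_int eq_u congr_u]].
  by apply: x_int; rewrite i0 ltnW.
have xn_int : x n.+1 \is a Zloc p by apply: x_int; rewrite leqnn.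
have eq_v : 1 + P * (u + x n.+1 + P * u * x n.+1) = (1 + P * u) * (1 + P * x n.+1) by ring.
exists (u + x n.+1 + P * u * x n.+1); split; first by zloc.
  by rewrite big_nat_recr //= -eq_u.
apply: congr_trans (plogM u_int xn_int eq_v) _.
by rewrite big_nat_recr //=; apply: congrD => //; apply: congr_refl.
Qed.

(* With [N i = r + p f], [0 < r < p], the residues [r = N i (1 - p f / (N i))]
   are a permutation of the [i], so the product of the [1 - p f / (N i)] is the
   inverse of [N ^ (p - 1)]. *)
Lemma plog_fermat_quotient_floor (N : nat) : (0 < N)%N -> coprime p N ->
  plog (fermat_quotient p N) ≡
  \sum_(1 <= i < p) (((N * i) %/ p)%:R / (N%:R * i%:R)
      + P * (((N * i) %/ p)%:R / (N%:R * i%:R)) ^+ 2 / 2) [p ^ 2].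
Proof.
move=> N_gt0 cpN; have N0 : N%:R != 0 :> rat by rewrite pnatr_eq0 -lt0n.
pose x i : rat := - (((N * i) %/ p)%:R / (N%:R * i%:R)).
have x_int i : (0 < i <= p.-1)%N -> x i \is a Zloc p.
  move=> /andP[_ lei]; apply: ZlocN; apply: ZlocM; first exact: Zloc_nat.
  rewrite invfM; apply: ZlocM; first exact: Zloc_inv.
  by apply: Zloc_inv_lt => //; lia.
have [u [u_int eq_u congr_u]] := plog_prod x_int.
rewrite prednK ?prime_gt0 // in eq_u congr_u.
have inv_u : 1 + P * 0 = (1 + P * fermat_quotient p N) * (1 + P * u).
  rewrite mulr0 addr0 fermat_quotientE eq_u.
  have prod0 : \prod_(1 <= i < p) i%:R != 0 :> rat.
    by rewrite -natr_prod pnatr_eq0 -lt0n big_nat_cond prodn_cond_gt0 // => i /andP[/andP[]].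
  apply: (mulIf prod0); rewrite mul1r -{1}natr_prod -(prod_modn_coprime p_pr cpN) natr_prod.
  have -> : N%:R ^+ p.-1 = \prod_(1 <= i < p) N%:R :> rat.
    by rewrite prodr_const_nat subn1.
  rewrite -!big_split /=; apply: eq_big_nat => i /andP[i0 ltip].
  have i0' : i%:R != 0 :> rat by rewrite pnatr_eq0 -lt0n.
  have -> : ((N * i) %% p)%:R = N%:R * i%:R - P * ((N * i) %/ p)%:R :> rat.
    by rewrite -natrM [in RHS](divn_eq (N * i) p) natrD natrM -divn_eq; ring.
  by rewrite /x; field; rewrite N0 i0'.
have := plogM (Zloc_fermat_quotient cpN) u_int inv_u.
rewrite plog0 => log_u.
apply: congr_trans (_ : - plog u ≡ _ [p ^ 2]); first by apply: congr_sub (congrN log_u) _; ring.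
apply: congr_trans (congrN congr_u) _; apply: congr_eq; rewrite -sumrN.
by apply: eq_big_nat => i _; rewrite /plog /x; ring.
Qed.

(** The floor $[Ni/p]$ counts the $j$ with $[jp/N]<i$. Exchanging the sums over $i$ and $j$ produces
    tails of harmonic sums, which equal minus the initial segments because the full sums vanish. *)
Lemma plog_fermat_quotient (N : nat) : (0 < N)%N -> coprime p N ->
  N%:R * plog (fermat_quotient p N) ≡
  - \sum_(1 <= j < N) (harmonic (j * p %/ N)
       + (j%:R *+ 2 - 1) * (P / (2 * N%:R) * harmonic2 (j * p %/ N))) [p ^ 2].
Proof.
move=> N_gt0 cpN; have N0 : N%:R != 0 :> rat by rewrite pnatr_eq0 -lt0n.
have := congrZ (Zloc_nat _ N) (plog_fermat_quotient_floor N_gt0 cpN).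
move/congr_trans; apply; rewrite mulr_sumr.
pose g (j i : nat) : rat := i%:R^-1 + (j%:R *+ 2 - 1) * (P / (2 * N%:R) * i%:R ^- 2).
have expand i : (1 <= i < p)%N ->
    N%:R * (((N * i) %/ p)%:R / (N%:R * i%:R)
            + P * (((N * i) %/ p)%:R / (N%:R * i%:R)) ^+ 2 / 2)
    = \sum_(1 <= j < N | (j * p %/ N < i)%N) g j i.
  move=> /andP[i0 ltip]; have i0' : i%:R != 0 :> rat by rewrite pnatr_eq0 -lt0n.
  have lt_f : ((N * i) %/ p < N)%N by rewrite ltn_divLR ?prime_gt0 // ltn_pmul2l.
  transitivity (\sum_(1 <= j < N | (j <= (N * i) %/ p)%N) g j i).
    by rewrite sum_leq_linear //; field; rewrite N0 i0'.
  apply: eq_bigl => j; rewrite leq_divRL ?prime_gt0 // ltn_divLR // [(i * N)%N]mulnC.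
  (* Equality $jp=Ni$ is impossible, since $p$ divides neither $N$ nor $i$. *)
  rewrite leq_eqVlt; case: eqP => // eq_jp; exfalso.
  have : (p %| N * i)%N by rewrite -eq_jp dvdn_mull.
  by rewrite Gauss_dvdr // gtnNdvd.
rewrite (eq_big_nat _ _ expand) (exchange_big_dep_nat predT) //= -sumrN.
apply: congr_sum_nat => j /andP[j0 ltjN].
have ltcp : (j * p %/ N < p)%N by rewrite ltn_divLR // mulnC ltn_pmul2l ?prime_gt0.
set c := (j * p %/ N)%N in ltcp *; set w := (j%:R *+ 2 - 1) * (P / (2 * N%:R)).
have sum_g a : \sum_(1 <= i < a.+1) g j i = harmonic a + w * harmonic2 a.
  rewrite big_split /= /harmonic2 mulr_sumr; congr (_ + _).
  by apply: eq_bigr => i _; rewrite /w; ring.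
have := sum_g p.-1; rewrite prednK ?prime_gt0 // (big_cat_nat (n := c.+1)) //= sum_g.
rewrite (big_nat_widenl c.+1 1) //=.
have w_int : (j%:R *+ 2 - 1) / 2 * N%:R^-1 \is a Zloc p.
  by zloc; [rewrite -mulr_natr; zloc | exact: Zloc_inv].
have full : w * harmonic2 p.-1 ≡ 0 [p ^ 2].
  have -> : w * harmonic2 p.-1 = (j%:R *+ 2 - 1) / 2 * N%:R^-1 * (P * harmonic2 p.-1).
    by rewrite /w; field.
  rewrite -(mulr0 ((j%:R *+ 2 - 1) / 2 * N%:R^-1)); apply: congrZ => //.
  by rewrite -(mulr0 P); apply/congrS/harmonic2_full.
move=> /(canRL (addKr _)) ->; apply: congr_sub (congrD (harmonic_full p_pr p_gt3) full) _.
by rewrite mulrA -/w; ring.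
Qed.

End FermatQuotient.

(** * Harmonic numbers at p/2, p/3, p/4 and p/6 in terms of logarithms *)

Section HarmonicLog.

Variables (p : nat) (p_pr : prime p) (p_gt3 : (3 < p)%N).
Local Notation P := (p%:R : rat).
Local Notation m := (p.-1)./2.
Local Notation l a := (plog p (fermat_quotient p a)).

Let p_odd : odd p. Proof. exact: odd_prime_gt3. Qed.

Let p_mod3 : (p %% 3 != 0)%N. Proof. exact: prime_gt3_mod3. Qed.

Lemma coprime_2 : coprime p 2. Proof. by rewrite coprimen2. Qed.

Lemma coprime_3 : coprime p 3.
Proof. by rewrite coprime_sym prime_coprime. Qed.

Lemma coprime_4 : coprime p 4. Proof. by rewrite (@coprimeXr 2 p 2) // coprime_2. Qed.

Lemma coprime_6 : coprime p 6. Proof. by rewrite (@coprimeMr p 2 3) coprime_2 coprime_3. Qed.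

Let two_int : 2^-1 \is a Zloc p. Proof. exact: Zloc_inv coprime_2. Qed.
Let three_int : 3^-1 \is a Zloc p. Proof. exact: Zloc_inv coprime_3. Qed.

Lemma p_harmonic2_half : P * harmonic2 m ≡ 0 [p ^ 2].
Proof. by rewrite -(mulr0 P); apply/congrS/harmonic2_half. Qed.

(** Merges the terms $j$ and $N-j$ of [plog_fermat_quotient], whose indices add up to $p-1$. For the
    weights $v=(2j-1)/(2N)$ and $w=(2N-2j-1)/(2N)$ the coefficient $1+v-w$ is $2j/N$. *)
Lemma harmonic_pair n (v w : rat) : (n < p)%N -> w \is a Zloc p ->
  harmonic n + v * (P * harmonic2 n)
    + (harmonic (p.-1 - n) + w * (P * harmonic2 (p.-1 - n)))
  ≡ 2 * harmonic n + (1 + v - w) * (P * harmonic2 n) [p ^ 2].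
Proof.
move=> ltnp w_int; have := harmonic_full p_pr p_gt3.
have := harmonic_reflect p_pr p_gt3 ltnp.
have /(congrS p_pr)/(congrZ w_int) := harmonic2_reflect p_pr p_gt3 ltnp.
move=> refl2 refl full.
by apply: congr_sub (congrD (congrB refl2 refl) full) _; ring.
Qed.

Lemma harmonic_half : harmonic m ≡ - 2 * l 2 [p ^ 2].
Proof.
have := plog_fermat_quotient p_pr p_gt3 (isT : (0 < 2)%N) coprime_2.
rewrite big_nat1 mul1n divn2; have -> : (p./2 = m)%N by lia.
move=> log2; have := congrZ (ZlocM two_int two_int) p_harmonic2_half => h2.
by apply: congr_sub (congrB log2 h2) _; field.
Qed.

Lemma harmonic_third :
  harmonic (p %/ 3) + P / 3 * harmonic2 (p %/ 3) ≡ - (3 / 2) * l 3 [p ^ 2].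
Proof.
have := plog_fermat_quotient p_pr p_gt3 (isT : (0 < 3)%N) coprime_3.
rewrite big_nat_recr //= big_nat1 mul1n.
have -> : (2 * p %/ 3 = p.-1 - p %/ 3)%N by lia.
move=> log3; have ltcp : (p %/ 3 < p)%N by lia.
have pair := harmonic_pair 6^-1 ltcp two_int.
apply: (@congrZK _ _ 2%:R) => //.
by apply: congr_sub (congrB log3 pair) _; field.
Qed.

Lemma plog4 : l 4 ≡ 2 * l 2 [p ^ 2].
Proof.
have q2 := Zloc_fermat_quotient p_pr p_gt3 coprime_2.
apply: (congr_trans (plogM p_pr p_gt3 q2 q2 _)); last by apply: congr_eq; ring.
by rewrite !fermat_quotientE // -exprMn -natrM.
Qed.

Lemma plog6 : l 6 ≡ l 2 + l 3 [p ^ 2].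
Proof.
have q2 := Zloc_fermat_quotient p_pr p_gt3 coprime_2.
have q3 := Zloc_fermat_quotient p_pr p_gt3 coprime_3.
by apply: plogM => //; rewrite !fermat_quotientE // -exprMn -natrM.
Qed.

Lemma harmonic_quarter :
  harmonic (p %/ 4) + P / 4 * harmonic2 (p %/ 4) ≡ - 3 * l 2 [p ^ 2].
Proof.
have := plog_fermat_quotient p_pr p_gt3 (isT : (0 < 4)%N) coprime_4.
rewrite 2?big_nat_recr //= big_nat1 mul1n.
have -> : (3 * p %/ 4 = p.-1 - p %/ 4)%N by lia.
have -> : (2 * p %/ 4 = m)%N by lia.
move=> log4; have ltcp : (p %/ 4 < p)%N by lia.
have w_int : 5 * (2^-1 ^+ 3) \is a Zloc p by zloc.
(* The weights $(2j-1)/8$ are $1/8$ and $5/8$ for the pair $j=1,3$, and $3/8$ for the middle term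
   $j=2$, whose index is $(p-1)/2$. *)
have pair := harmonic_pair 8^-1 ltcp w_int.
have h2 : 3 * (2^-1 ^+ 3) * (P * harmonic2 m) ≡ 3 * (2^-1 ^+ 3) * 0 [p ^ 2].
  by apply: congrZ; [zloc | exact: p_harmonic2_half].
apply: (@congrZK _ _ 2%:R) => //.
have q4 := congrZ (Zloc_nat p 4) plog4.
apply: congr_sub (congrB (congrB (congrB log4 pair) h2) (congrD harmonic_half q4)) _.
by field.
Qed.

Lemma harmonic_sixth :
  harmonic (p %/ 6) + P / 6 * harmonic2 (p %/ 6) ≡ - 2 * l 2 - 3 / 2 * l 3 [p ^ 2].
Proof.
have := plog_fermat_quotient p_pr p_gt3 (isT : (0 < 6)%N) coprime_6.
rewrite 4?big_nat_recr //= big_nat1 mul1n.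
have -> : (5 * p %/ 6 = p.-1 - p %/ 6)%N by lia.
have -> : (4 * p %/ 6 = p.-1 - p %/ 3)%N by lia.
have -> : (3 * p %/ 6 = m)%N by lia.
have -> : (2 * p %/ 6 = p %/ 3)%N by lia.
move=> log6; have ltcp : (p %/ 6 < p)%N by lia.
have ltc3p : (p %/ 3 < p)%N by lia.
(* The weights are $(2j-1)/12$: the pair $j=1,5$ yields $[p/6]$, the pair $j=2,4$ yields the
   combination of [harmonic_third], and $j=3$ is the middle term. *)
have w_int k : k%:R * (2^-1 ^+ 2 * 3^-1) \is a Zloc p by zloc.
have pair1 := harmonic_pair 12^-1 ltcp (w_int 9).
have pair2 := harmonic_pair 4^-1 ltc3p (w_int 7).
have h2 := congrZ (w_int 5) p_harmonic2_half.
apply: (@congrZK _ _ 2%:R) => //.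
have q6 := congrZ (Zloc_nat p 6) plog6.
have h3 := congrZ (Zloc_nat p 2) harmonic_third.
apply: congr_sub (congrB (congrB (congrB log6 (congrD pair1 pair2)) h2)
  (congrD (congrD harmonic_half q6) h3)) _.
by field.
Qed.

End HarmonicLog.

(** * The Euler numbers, the numbers U and their Appell polynomials *)

Lemma even_rec_odd c n : odd n -> even_rec c n = 0.
Proof.
elim/ltn_ind: n => n IHn n_odd; have n_gt0 : (0 < n)%N by case: n n_odd {IHn}.
rewrite even_recS // big_nat_cond big1 ?mulr0 // => k /andP[/andP[k_gt0 lek] _].
by rewrite IHn ?mulr0 //; lia.
Qed.

Lemma sum_even_terms (R : comPzRingType) (F : nat -> R) n :
  \sum_(0 <= i < n.+1) F i * (1 + (-1) ^+ i) = 2 * \sum_(0 <= k < n./2.+1) F (2 * k)%N.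
Proof.
elim: n => [|n IHn]; first by rewrite !big_nat1 muln0 expr0; ring.
rewrite big_nat_recr // IHn /= uphalf_half -signr_odd oddS.
case: (boolP (odd n)) => [n_odd|_] /=; last by rewrite expr1; ring.
rewrite add1n [in RHS]big_nat_recr //=.
have -> : (2 * n./2.+1 = n.+1)%N by lia.
by ring.
Qed.

(** The recursion, with the factor $1+(-1)^{n-i}$ selecting even steps. In generating functions,
    $(2c\cosh t+2-2c)\sum_n a_nt^n/n!=2$. *)
Lemma even_rec_sum c n :
  c * \sum_(0 <= i < n.+1) ('C(n, i))%:Z * even_rec c i * (1 + (-1) ^+ (n - i))
    + (2 - 2 * c) * even_rec c n = 2 * (n == 0%N)%:R.
Proof.
rewrite big_nat_rev /=.
rewrite (eq_big_nat _ _ (F2 := fun i => ('C(n, i))%:Z * even_rec c (n - i) * (1 + (-1) ^+ i)));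
    last first.
  move=> i /andP[_ lein]; have -> : (0 + n.+1 - i.+1 = n - i)%N by lia.
  by rewrite bin_sub // subKn.
rewrite sum_even_terms big_ltn // muln0 subn0 bin0 mul1r.
case: n => [|n]; first by rewrite big_geq //= /even_rec /=; ring.
have := even_recS c (ltn0Sn n).
move=> rec; rewrite /= mulr0; set S := \sum_(_ <= _ < _) _ in rec *.
rewrite -[RHS](mulr0 2) -[X in _ = _ * X](subrr (even_rec c n.+1)) [in X in _ = _ * (_ - X)]rec.
by ring.
Qed.

(** Both sides are the trinomial coefficient $n!/(j!\,k!\,(n-j-k)!)$, and both vanish when
    $j+k>n$. *)
Lemma bin_mul_sub n j k : ('C(n, j) * 'C(n - j, k) = 'C(n, k) * 'C(n - k, j))%N.
Proof.
have [lejk|ltjk] := leqP (j + k) n; last first.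
  have [ltnj|lejn] := ltnP n j.
    by rewrite [in LHS]bin_small // mul0n [X in (_ * X)%N]bin_small ?muln0 //; lia.
  rewrite [X in (_ * X)%N]bin_small ?muln0; last by lia.
  have [ltnk|lekn] := ltnP n k; first by rewrite bin_small.
  by rewrite [X in (_ * X)%N]bin_small ?muln0 //; lia.
have f_gt0 : (0 < j`! * k`! * (n - j - k)`!)%N by rewrite !muln_gt0 !fact_gt0.
apply/eqP; rewrite -(eqn_pmul2r f_gt0); apply/eqP.
have lejn : (j <= n)%N by lia.
have lekn : (k <= n)%N by lia.
have lekj : (k <= n - j)%N by lia.
have lejk' : (j <= n - k)%N by lia.
have e1 := bin_fact lejn; have e2 := bin_fact lekj.
have e3 := bin_fact lekn; have e4 := bin_fact lejk'.
have e5 : (n - k - j = n - j - k)%N by lia.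
rewrite e5 in e4.
transitivity n`!; first by rewrite -e1 -e2; ring.
by rewrite -e3 -e4; ring.
Qed.

(** Its exponential generating function is $e^{xt}\sum_n a_nt^n/n!$. For $c=1$ it is
    $2^nE_n((x+1)/2)$ with $E_n$ the Euler polynomial. *)
Definition even_appell (c : int) (n : nat) (x : rat) : rat :=
  \sum_(0 <= j < n.+1) 'C(n, j)%:R * (even_rec c j)%:~R * x ^+ (n - j).

(** Padding with zero terms gives all expansions the same range, so that the double sum in
    [even_appell_shift] can be exchanged. *)
Lemma exprDn_wide (e x : rat) (N n : nat) : (N <= n)%N ->
  (x + e) ^+ N = \sum_(0 <= k < n.+1) 'C(N, k)%:R * e ^+ (N - k) * x ^+ k.
Proof.
move=> leNn; rewrite (big_cat_nat (n := N.+1)) //= [X in _ = _ + X]big_nat_cond.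
rewrite [X in _ = _ + X]big1 => [|k /andP[/andP[ltNk _] _]]; last by rewrite bin_small ?mul0r.
rewrite addr0 addrC exprDn big_mkord; apply: eq_bigr => k _.
by rewrite -mulr_natl mulrA.
Qed.

Lemma even_appell_shift c n e x :
  even_appell c n (x + e) =
  \sum_(0 <= k < n.+1) 'C(n, k)%:R * x ^+ k
    * \sum_(0 <= j < (n - k).+1) 'C(n - k, j)%:R * (even_rec c j)%:~R * e ^+ (n - k - j).
Proof.
transitivity (\sum_(0 <= j < n.+1) \sum_(0 <= k < n.+1)
   'C(n, j)%:R * 'C(n - j, k)%:R * (even_rec c j)%:~R * e ^+ (n - j - k) * x ^+ k : rat).
  apply: eq_big_nat => j /andP[_ lejn].
  rewrite (exprDn_wide e x (leq_subr j n)) mulr_sumr; apply: eq_bigr => k _; ring.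
rewrite exchange_big_nat /=; apply: eq_big_nat => k /andP[_ lekn].
rewrite (big_cat_nat (n := (n - k).+1)) ?ltnS ?leq_subr //= [X in _ + X]big_nat_cond.
rewrite [X in _ + X]big1 => [|j /andP[/andP[ltj _] _]]; last first.
  by rewrite -natrM bin_mul_sub [X in (_ * X)%N]bin_small ?muln0 ?mul0r.
rewrite addr0 mulr_sumr; apply: eq_bigr => j _.
rewrite -natrM bin_mul_sub natrM subnAC; ring.
Qed.

Lemma even_appell_rev c n x :
  even_appell c n x = \sum_(0 <= k < n.+1) 'C(n, k)%:R * x ^+ k * (even_rec c (n - k))%:~R.
Proof.
rewrite /even_appell big_nat_rev; apply: eq_big_nat => j /andP[_ lejn].
have -> : (0 + n.+1 - j.+1 = n - j)%N by lia.
by rewrite bin_sub // subKn //; ring.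
Qed.

Lemma even_rec_sumQ c n :
  c%:~R * (\sum_(0 <= j < n.+1) 'C(n, j)%:R * (even_rec c j)%:~R * 1 ^+ (n - j)
           + \sum_(0 <= j < n.+1) 'C(n, j)%:R * (even_rec c j)%:~R * (-1) ^+ (n - j))
    + (2 - 2 * c%:~R) * (even_rec c n)%:~R = 2 * (n == 0%N)%:R :> rat.
Proof.
transitivity ((2 * (n == 0%N)%:R : int)%:~R : rat); last by rewrite intrM !rmorph_nat.
rewrite -(even_rec_sum c n) intrD !intrM intrB intrM; congr (_ * _ + _).
rewrite -big_split /= (raddf_sum (intr : int -> rat)).
apply: eq_bigr => j _; rewrite expr1n /= !intrM intrD rmorphXn /= rmorphN1 -pmulrn; ring.
Qed.

(* Specializes to [G (x + 1) + G (x - 1) = 2 x ^ n] for the Euler numbers and to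
   [G (x + 1) - G x + G (x - 1) = x ^ n] for the numbers [U_n]. *)
Lemma even_appell_rec (c : int) n x :
  c%:~R * (even_appell c n (x + 1) + even_appell c n (x - 1))
    + (2 - 2 * c%:~R) * even_appell c n x = 2 * x ^+ n.
Proof.
rewrite !even_appell_shift even_appell_rev -big_split /= !mulr_sumr -big_split /=.
transitivity (\sum_(0 <= k < n.+1) 'C(n, k)%:R * x ^+ k * (2 * (n - k == 0)%N%:R) : rat).
  by apply: eq_bigr => k _; rewrite -(even_rec_sumQ c); ring.
rewrite big_nat_recr //= subnn binn big_nat_cond big1 => [|k /andP[/andP[_ ltkn] _]].
  by rewrite eqxx add0r !mul1r mulr1 mulrC.
by rewrite subn_eq0 leqNgt ltkn !mulr0.
Qed.

Lemma even_appell_even c n x : ~~ odd n -> even_appell c n (- x) = even_appell c n x.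
Proof.
move=> n_even; apply: eq_big_nat => j /andP[_ lejn].
have [j_odd|j_even] := boolP (odd j); first by rewrite even_rec_odd // !(mulr0, mul0r).
by rewrite exprNn -signr_odd oddB // (negbTE n_even) (negbTE j_even) mul1r.
Qed.

Lemma even_appell0 c n : even_appell c n 0 = (even_rec c n)%:~R.
Proof.
rewrite /even_appell big_nat_recr //= subnn binn big_nat_cond big1.
  by ring.
by move=> k /andP[/andP[_ ltkn] _]; rewrite expr0n subn_eq0 leqNgt ltkn mulr0.
Qed.

Lemma alternating_telescope (g f : nat -> rat) J :
  (forall j, (j < J)%N -> g j.+1 + g j = f j) ->
  (-1) ^+ J * g J - g 0 = \sum_(0 <= j < J) (-1) ^+ j.+1 * f j.
Proof.
elim: J => [|J IHJ] rec; first by rewrite big_geq //; ring.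
rewrite big_nat_recr //= -IHJ => [|j ltjJ]; last by apply: rec; apply: ltnW.
by rewrite -(rec J) // !exprS; ring.
Qed.

(** * Second-order harmonic sums modulo p by telescoping Appell polynomials *)

Section EvenNumbers.

Variables (p : nat) (p_pr : prime p) (p_gt3 : (3 < p)%N).
Local Notation P := (p%:R : rat).
Local Notation m := (p.-1)./2.
Local Notation n := (p - 3)%N.

Let p_odd : odd p. Proof. exact: odd_prime_gt3. Qed.

Let n_even : ~~ odd n.
Proof. by lia. Qed.

Let n_gt0 : (0 < n)%N.
Proof. by lia. Qed.

Lemma even_appell_p c : even_appell c n P ≡ (even_rec c n)%:~R [p ^ 1].
Proof.
rewrite -even_appell0; apply: congr_sum_nat => j /andP[_ lejn].
apply: congrZ; first by zloc.
case: (n - j)%N => [|k]; first by rewrite !expr0 congr_refl.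
by rewrite /congr_pow exprS expr0n subr0 mulrC; apply: (ZpowZ _ (Zpow_exp p_pr 1)); zloc.
Qed.

Lemma congr_exp_inv2 i : (0 < i < p)%N -> i%:R ^+ n ≡ i%:R ^- 2 [p ^ 1].
Proof.
move=> /andP[i0 ltip]; have i0' : i%:R != 0 :> rat by rewrite pnatr_eq0 -lt0n.
have cpi : coprime p i by rewrite prime_coprime // gtnNdvd.
have i_int := Zloc_inv cpi.
have q_int : fermat_quotient p i \is a Zloc p by exact: Zloc_fermat_quotient.
rewrite /congr_pow.
have -> : i%:R ^+ n - i%:R ^- 2 = i%:R ^- 2 * fermat_quotient p i * P ^+ 1 :> rat.
  have := fermat_quotientE p_pr i; have -> : p.-1 = (2 + n)%N by lia.
  rewrite exprD => eq_q; apply: (@mulfI _ (i%:R ^+ 2)); first by rewrite expf_neq0.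
  by rewrite mulrBr -eq_q; field.
by apply: (ZpowZ _ (Zpow_exp p_pr 1)); rewrite -exprVn; zloc.
Qed.

(** The equation $G(x+1)+G(x-1)=2x^n$ telescopes in steps of 2 from $G(1)=0$ to $G(p)\equiv
    E_{p-3}$. The powers met are $(2j)^{p-3}\equiv(2j)^{-2}$, with alternating signs. *)
Lemma euler_number_harmonic2 :
  harmonic2 (p %/ 4) ≡ 4 * ((-1) ^+ m * (euler_number n)%:~R) [p ^ 1].
Proof.
have rec x : even_appell 1 n (x + 1) + even_appell 1 n (x - 1) = 2 * x ^+ n.
  by rewrite -(even_appell_rec 1); ring.
(* At $x=0$ the equation and the evenness of $G$ give $2G(1)=0$. *)
have G1 : even_appell 1 n 1 = 0.
  have := rec 0; rewrite add0r sub0r even_appell_even // expr0n -leqn0 leqNgt n_gt0 /=.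
  by move: (even_appell _ _ _) => G1; lra.
pose g j := even_appell 1 n (2 * j%:R + 1).
have tel : (-1) ^+ m * g m - g 0%N = \sum_(0 <= j < m) (-1) ^+ j.+1 * (2 * (2 * j.+1%:R) ^+ n).
  apply: alternating_telescope => j _; rewrite /g -rec -natr1.
  by congr (even_appell _ _ _ + even_appell _ _ _); ring.
move: tel; rewrite {1 2}/g mulr0 add0r G1 subr0.
have -> : 2 * m%:R + 1 = P by rewrite -natrM natr1; congr _%:R; lia.
move=> tel; have sgn_int : (-1) ^+ m * (-1) ^+ m = 1 :> rat by rewrite -expr2 sqrr_sign.
have sum_congr : \sum_(0 <= j < m) (-1) ^+ j.+1 * (2 * (2 * j.+1%:R) ^+ n)
    ≡ 2^-1 * (harmonic2 m./2 / 2 - harmonic2 m) [p ^ 1].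
  rewrite -alternating_harmonic2 big_add1 mulr_sumr; apply: congr_sum_nat => j /andP[_ ltjm].
  have bnd : (0 < 2 * j.+1 < p)%N by lia.
  have j0 : j.+1%:R != 0 :> rat by rewrite pnatr_eq0.
  have -> : 2^-1 * ((-1) ^+ j.+1 * j.+1%:R ^- 2)
            = (-1) ^+ j.+1 * (2 * (2 * j.+1)%N%:R ^- 2) :> rat.
    by rewrite natrM; move: (j.+1%:R) ((-1) ^+ j.+1) j0 => x y x0; field.
  by rewrite -natrM; do 2![apply: congrZ; first by zloc]; apply: congr_exp_inv2.
rewrite -tel in sum_congr.
have -> : (p %/ 4 = m./2)%N by lia.
have half : (2^-1 : rat) * harmonic2 m ≡ 2^-1 * 0 [p ^ 1].
  by apply: congrZ; [apply: Zloc_inv; rewrite coprimen2 | apply: harmonic2_half].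
have s_int : (-1) ^+ m \is a Zloc p by zloc.
have four_int := Zloc_nat p 4.
have := congrZ four_int (congrB (congrZ s_int (even_appell_p 1)) (congrB sum_congr half)).
rewrite /euler_number => final; apply: congr_sub final _.
by field.
Qed.

(* The substitution [j -> J - j] replaces [3 j + r] by [p - (3 j + r)] and changes
   the sign, [J] being odd. *)
Lemma alternating_symmetric_sum J r : (3 * J + 2 * r = p)%N ->
  \sum_(0 <= j < J.+1) (-1) ^+ j.+1 * (3 * j + r)%N%:R ^+ n ≡ 0 [p ^ 1].
Proof.
move=> eq_p; set S := \sum_(_ <= _ < _) _.
have anti : S ≡ - S [p ^ 1].
  rewrite {1}/S big_nat_rev /= /S -sumrN; apply: congr_sum_nat => j /andP[_ lejJ].
  have -> : (-1) ^+ (0 + J.+1 - j.+1).+1 = - (-1) ^+ j.+1 :> rat.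
    rewrite -signr_odd -[in RHS]signr_odd; have -> : odd (0 + J.+1 - j.+1).+1 = ~~ odd j.+1 by lia.
    by rewrite signrN.
  have -> : (3 * (0 + J.+1 - j.+1) + r)%N%:R = P - (3 * j + r)%N%:R :> rat.
    by rewrite -natrB; [congr _%:R; lia | lia].
  rewrite mulNr -!mulrN; apply: congrZ; first by zloc.
  apply: congrN; rewrite -[X in _ ≡ X [_ ^ _]](_ : (- (3 * j + r)%N%:R) ^+ n = _); last first.
    by rewrite exprNn -signr_odd (negbTE n_even) mul1r.
  apply: congrX; [by zloc | by zloc |].
  by rewrite /congr_pow opprK subrK -[P]expr1 (Zpow_exp p_pr 1).
have two_int : 2^-1 \is a Zloc p by apply: Zloc_inv; rewrite coprimen2.
apply: (@congrZK _ _ 2%:R) => //.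
by apply: congr_sub anti _; ring.
Qed.

Let p_mod3 : (p %% 3 != 0)%N. Proof. exact: prime_gt3_mod3. Qed.

(** The sum is $\frac19\left(\frac12H^{(2)}_{[p/6]}-H^{(2)}_{[p/3]}\right)$ modulo $p$, and
    [harmonic2_sixth] turns the bracket into $\frac32H^{(2)}_{[p/3]}$. *)
Lemma alternating_third_sum :
  \sum_(0 <= j < p %/ 3) (-1) ^+ j.+1 * (3 * j.+1)%N%:R ^+ n
  ≡ 6^-1 * harmonic2 (p %/ 3) [p ^ 1].
Proof.
have cp6 : coprime p 6.
  by rewrite (@coprimeMr p 2 3) coprimen2 p_odd coprime_sym prime_coprime.
have cp3 : coprime p 3 by rewrite coprime_sym prime_coprime.
have cp2 : coprime p 2 by rewrite coprimen2.
have i2 := Zloc_inv cp2; have i3 := Zloc_inv cp3.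
apply: (congr_trans (y := 9^-1 * (harmonic2 (p %/ 3)./2 / 2 - harmonic2 (p %/ 3)))).
  rewrite -alternating_harmonic2 big_add1 mulr_sumr; apply: congr_sum_nat => j /andP[_ ltj].
  have bnd : (0 < 3 * j.+1 < p)%N by lia.
  have j0 : j.+1%:R != 0 :> rat by rewrite pnatr_eq0.
  have -> : 9^-1 * ((-1) ^+ j.+1 * j.+1%:R ^- 2) = (-1) ^+ j.+1 * (3 * j.+1)%N%:R ^- 2 :> rat.
    by rewrite natrM; move: (j.+1%:R) ((-1) ^+ j.+1) j0 => x y x0; field.
  by apply: congrZ; [zloc | apply: congr_exp_inv2].
have -> : ((p %/ 3)./2 = p %/ 6)%N by lia.
have c_int : 3^-1 * 3^-1 * 2^-1 \is a Zloc p by zloc.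
by apply: congr_sub (congrZ c_int (harmonic2_sixth p_pr p_gt3)) _; field.
Qed.

(** Adding the three-term equations at $x+1$ and $x+2$ gives a two-term one with step 3, which
    telescopes to $G(p)$ from $G(1)$ or $G(-1)$ according to $p$ modulo 3. Of the two resulting
    power sums one vanishes by symmetry; the other runs over multiples of 3. *)
Lemma U_number_harmonic2 :
  harmonic2 (p %/ 3) ≡ 3 * (legendre3 p * (U_number n)%:~R) [p ^ 1].
Proof.
pose G := even_appell 2 n.
have rec x : G (x + 1) + G (x - 1) - G x = x ^+ n.
  by apply: (@mulfI _ 2) => //; rewrite -(even_appell_rec 2) -/G; ring.
have rec3 x : G (x + 3) + G x = (x + 1) ^+ n + (x + 2) ^+ n.
  rewrite -!rec; have -> : x + 1 + 1 = x + 2 by ring.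
  have -> : x + 2 + 1 = x + 3 by ring.
  have -> : x + 2 - 1 = x + 1 by ring.
  have -> : x + 1 - 1 = x by ring.
  by ring.
(* At $x=0$ the equation reads $2G(1)-G(0)=0$, and $G(0)=U_{p-3}$. *)
have G1 : G 1 = 2^-1 * (U_number n)%:~R.
  have := rec 0; rewrite add0r sub0r /G even_appell_even // expr0n -leqn0 leqNgt n_gt0 /=.
  by rewrite even_appell0 /U_number; move: (even_appell _ _ _) (_%:~R) => a b; lra.
have GN1 : G (- 1) = 2^-1 * (U_number n)%:~R by rewrite -G1 /G even_appell_even.
have Gp : G P ≡ (U_number n)%:~R [p ^ 1] by apply: even_appell_p.
have third := alternating_third_sum; set K := (p %/ 3)%N in third *.
have six := Zloc_nat p 6.
have [p1|p2] : (p = 3 * K + 1 \/ p = 3 * K + 2)%N by rewrite /K; lia.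
  have -> : legendre3 p = 1 by rewrite /legendre3; have -> : (p %% 3 = 1)%N by lia.
  have K_even : ~~ odd K by lia.
  have tel : (-1) ^+ K * G (3 * K%:R + 1) - G 1
      = \sum_(0 <= j < K) (-1) ^+ j.+1 * ((3 * j + 2)%N%:R ^+ n + (3 * j.+1)%N%:R ^+ n).
    have := @alternating_telescope (fun j => G (3 * j%:R + 1))
      (fun j => (3 * j + 2)%N%:R ^+ n + (3 * j.+1)%N%:R ^+ n) K _.
    rewrite mulr0 add0r; apply=> j _.
    have -> : 3 * j.+1%:R + 1 = 3 * j%:R + 1 + 3 :> rat by rewrite -natr1; ring.
    rewrite rec3; congr (_ ^+ _ + _ ^+ _).
      by rewrite natrD natrM; ring.
    by rewrite natrM -natr1; ring.
  have sym : \sum_(0 <= j < K) (-1) ^+ j.+1 * (3 * j + 2)%N%:R ^+ n ≡ 0 [p ^ 1].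
    have eq_p : (3 * K.-1 + 2 * 2 = p)%N by lia.
    by have := alternating_symmetric_sum eq_p; rewrite prednK //; lia.
  move: tel; rewrite -natrM natr1 -addn1 -p1 -signr_odd (negbTE K_even) mul1r G1.
  rewrite (eq_bigr _ (fun j _ => mulrDr _ _ _)) big_split /= => tel.
  have := congrD sym third; rewrite -tel => sum_congr.
  by apply: congr_sub (congrZ six (congrB Gp sum_congr)) _; field.
have -> : legendre3 p = -1 by rewrite /legendre3; have -> : (p %% 3 = 2)%N by lia.
have K_odd : odd K by lia.
have tel : (-1) ^+ K.+1 * G (3 * K.+1%:R - 1) - G (- 1)
    = \sum_(0 <= j < K.+1) (-1) ^+ j.+1 * ((3 * j)%N%:R ^+ n + (3 * j + 1)%N%:R ^+ n).
  have := @alternating_telescope (fun j => G (3 * j%:R - 1))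
    (fun j => (3 * j)%N%:R ^+ n + (3 * j + 1)%N%:R ^+ n) K.+1 _.
  rewrite mulr0 add0r; apply=> j _.
  have -> : 3 * j.+1%:R - 1 = 3 * j%:R - 1 + 3 :> rat by rewrite -natr1; ring.
  rewrite rec3; congr (_ ^+ _ + _ ^+ _).
    by rewrite natrM; ring.
  by rewrite natrD natrM; ring.
have sym : \sum_(0 <= j < K.+1) (-1) ^+ j.+1 * (3 * j + 1)%N%:R ^+ n ≡ 0 [p ^ 1].
  by apply: alternating_symmetric_sum; lia.
move: tel; rewrite -signr_odd /= K_odd mul1r GN1.
have -> : 3 * K.+1%:R - 1 = P by rewrite p2 natrD natrM -natr1; ring.
(* The sum over multiples of 3 begins with $0^n=0$; dropping this term shifts the index and reverses
   the signs, which accounts for the value $-1$ of the Legendre symbol. *)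
rewrite (eq_bigr _ (fun j _ => mulrDr _ _ _)) big_split /= [X in _ = X + _ -> _]big_ltn // muln0.
rewrite expr0n -leqn0 leqNgt n_gt0 /= mulr0 add0r big_add1 => tel.
have eq_third : \sum_(0 <= j < K) (-1) ^+ j.+2 * (3 * j.+1)%N%:R ^+ n
    = - \sum_(0 <= j < K) (-1) ^+ j.+1 * (3 * j.+1)%N%:R ^+ n :> rat.
  by rewrite -sumrN; apply: eq_bigr => j _; rewrite exprS; ring.
have := congrB sym third; rewrite -[X in X ≡ _ [_ ^ _]]addrC -eq_third -tel => sum_congr.
by apply: congr_sub (congrZ six (congrB sum_congr Gp)) _; field.
Qed.

End EvenNumbers.

(** * The summands as products of generalized binomial coefficients *)

Lemma binprod_sym a k : binprod (-1 - a) k = binprod a k.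
Proof. by apply: eq_bigr => j _; rewrite -natr1; ring. Qed.

Lemma binprod_unique a (F : nat -> rat) : F 0%N = 1 ->
  (forall k, F k.+1 = F k * (- (a + k.+1%:R) * (a - k%:R) / k.+1%:R ^+ 2)) ->
  forall k, F k = binprod a k.
Proof.
move=> F0 FS; elim=> [|k IHk]; first by rewrite F0 /binprod big_geq.
by rewrite FS IHk binprodS.
Qed.

Lemma fact_neq0 n : n`!%:R != 0 :> rat.
Proof. by rewrite pnatr_eq0 -lt0n fact_gt0. Qed.

Lemma natr_bin (n k : nat) : (k <= n)%N ->
  'C(n, k)%:R = n`!%:R / (k`!%:R * (n - k)`!%:R) :> rat.
Proof.
by move=> lekn; rewrite -(bin_fact lekn) !natrM mulfK // mulf_neq0 // fact_neq0.
Qed.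

Lemma fact_mul2S k :
  (2 * k.+1)`!%:R = (2 * k%:R + 2) * (2 * k%:R + 1) * (2 * k)`!%:R :> rat.
Proof.
have -> : (2 * k.+1 = (2 * k).+2)%N by lia.
by rewrite !factS !natrM -!natr1 natrM; ring.
Qed.

Lemma fact_mul3S k :
  (3 * k.+1)`!%:R
  = (3 * k%:R + 3) * (3 * k%:R + 2) * (3 * k%:R + 1) * (3 * k)`!%:R :> rat.
Proof.
have -> : (3 * k.+1 = (3 * k).+3)%N by lia.
by rewrite !factS !natrM -!natr1 natrM; ring.
Qed.

Lemma fact_mul4S k :
  (4 * k.+1)`!%:R = (4 * k%:R + 4) * (4 * k%:R + 3) * (4 * k%:R + 2)
                    * (4 * k%:R + 1) * (4 * k)`!%:R :> rat.
Proof.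
have -> : (4 * k.+1 = (4 * k).+4)%N by lia.
by rewrite !factS !natrM -!natr1 natrM; ring.
Qed.

Lemma fact_mul6S k :
  (6 * k.+1)`!%:R = (6 * k%:R + 6) * (6 * k%:R + 5) * (6 * k%:R + 4) * (6 * k%:R + 3)
                    * (6 * k%:R + 2) * (6 * k%:R + 1) * (6 * k)`!%:R :> rat.
Proof.
have -> : (6 * k.+1 = (6 * k).+4.+2)%N by lia.
by rewrite !factS !natrM -!natr1 natrM; ring.
Qed.

Lemma linear_neq0 (a b k : nat) : (0 < b)%N -> a%:R * k%:R + b%:R != 0 :> rat.
Proof. by move=> b_gt0; rewrite -natrM -natrD pnatr_eq0 -lt0n; lia. Qed.

(** The quotient of factorials has consecutive ratio $(k+\frac14)(k+\frac34)/(k+1)^2$, the factor of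
    [binprod] at $-1/4$. The thirds and sixths below work in the same way. *)
Lemma binprod_quarter k :
  ('C(2 * k, k) * 'C(4 * k, 2 * k))%N%:R / 64 ^+ k = binprod (- 4^-1) k.
Proof.
pose F k : rat := (4 * k)`!%:R / (k`!%:R ^+ 2 * (2 * k)`!%:R * 64 ^+ k).
have E0 n : 64 ^+ n != 0 :> rat by rewrite expf_neq0 // pnatr_eq0.
transitivity (F k); last first.
  apply: binprod_unique k => [|k]; first by rewrite /F !muln0 fact0; field.
  rewrite /F fact_mul4S fact_mul2S factS natrM [64 ^+ _]exprS -[k.+1%:R]natr1.
  have k0 := linear_neq0 1 k (isT : (0 < 1)%N); rewrite mul1r in k0.
  have k1 := linear_neq0 2 k (isT : (0 < 1)%N).
  have k2 := linear_neq0 2 k (isT : (0 < 2)%N).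
  move: (64 ^+ k) (k`!%:R) ((2 * k)`!%:R) ((4 * k)`!%:R) k%:R
    (E0 k) (fact_neq0 k) (fact_neq0 (2 * k)) k0 k1 k2.
  by move=> E f f2 f4 x Ek f0 f20 k0 k1 k2; field; rewrite Ek f0 f20 k0 k1 k2.
rewrite natrM !natr_bin; try lia.
have -> : (2 * k - k = k)%N by lia.
have -> : (4 * k - 2 * k = 2 * k)%N by lia.
rewrite /F; move: (64 ^+ k) (E0 k) (fact_neq0 k) (fact_neq0 (2 * k)) => E Ek f1 f2.
by field; rewrite Ek f1 f2.
Qed.

Lemma binprod_third k :
  ('C(2 * k, k) * 'C(3 * k, k))%N%:R / 27 ^+ k = binprod (- 3^-1) k.
Proof.
pose F k : rat := (3 * k)`!%:R / (k`!%:R ^+ 3 * 27 ^+ k).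
have E0 n : 27 ^+ n != 0 :> rat by rewrite expf_neq0 // pnatr_eq0.
transitivity (F k); last first.
  apply: binprod_unique k => [|k]; first by rewrite /F !muln0 fact0; field.
  rewrite /F fact_mul3S factS natrM [27 ^+ _]exprS -[k.+1%:R]natr1.
  have k0 := linear_neq0 1 k (isT : (0 < 1)%N); rewrite mul1r in k0.
  move: (27 ^+ k) (k`!%:R) ((3 * k)`!%:R) k%:R (E0 k) (fact_neq0 k) k0.
  by move=> E f f3 x Ek f0 k0; field; rewrite Ek f0 k0.
rewrite natrM !natr_bin; try lia.
have -> : (2 * k - k = k)%N by lia.
have -> : (3 * k - k = 2 * k)%N by lia.
rewrite /F; move: (27 ^+ k) (E0 k) (fact_neq0 k) (fact_neq0 (2 * k)) => E Ek f1 f2.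
by field; rewrite Ek f1 f2.
Qed.

Lemma binprod_sixth k :
  ('C(3 * k, k) * 'C(6 * k, 3 * k))%N%:R / 432 ^+ k = binprod (- 6^-1) k.
Proof.
pose F k : rat := (6 * k)`!%:R / (k`!%:R * (2 * k)`!%:R * (3 * k)`!%:R * 432 ^+ k).
have E0 n : 432 ^+ n != 0 :> rat by rewrite expf_neq0 // pnatr_eq0.
transitivity (F k); last first.
  apply: binprod_unique k => [|k]; first by rewrite /F !muln0 fact0; field.
  rewrite /F fact_mul6S fact_mul3S fact_mul2S factS natrM [432 ^+ _]exprS -[k.+1%:R]natr1.
  have k0 := linear_neq0 1 k (isT : (0 < 1)%N); rewrite mul1r in k0.
  have k1 := linear_neq0 2 k (isT : (0 < 1)%N).
  have k2 := linear_neq0 2 k (isT : (0 < 2)%N).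
  have k3 := linear_neq0 3 k (isT : (0 < 1)%N).
  have k4 := linear_neq0 3 k (isT : (0 < 2)%N).
  have k5 := linear_neq0 3 k (isT : (0 < 3)%N).
  move: (432 ^+ k) (k`!%:R) ((2 * k)`!%:R) ((3 * k)`!%:R) ((6 * k)`!%:R) k%:R
    (E0 k) (fact_neq0 k) (fact_neq0 (2 * k)) (fact_neq0 (3 * k)) k0 k1 k2 k3 k4 k5.
  move=> E f f2 f3 f6 x Ek f0 f20 f30 k0 k1 k2 k3 k4 k5.
  by field; rewrite Ek f0 f20 f30 k0 k1 k2 k3 k4 k5.
rewrite natrM !natr_bin; try lia.
have -> : (3 * k - k = 2 * k)%N by lia.
have -> : (6 * k - 3 * k = 3 * k)%N by lia.
rewrite /F; move: (432 ^+ k) (E0 k)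
  (fact_neq0 k) (fact_neq0 (2 * k)) (fact_neq0 (3 * k)) => E Ek f1 f2 f3.
by field; rewrite Ek f1 f2 f3.
Qed.

(** * Assembly of the three congruences *)

Section Assembly.

Variables (p : nat) (p_pr : prime p) (p_gt3 : (3 < p)%N).
Local Notation P := (p%:R : rat).
Local Notation m := (p.-1)./2.

Let p_odd : odd p. Proof. exact: odd_prime_gt3. Qed.

(* With [n = p %/ N], the rational [n - p / N] is [-1 / N] or [-1 - (-1 / N)], and
   these two arguments have the same [binsum]. *)
Lemma binsum_unit_fraction N : (2 < N)%N -> coprime p N ->
  (p %% N = 1)%N \/ (p %% N = N.-1)%N ->
  binsum m (- N%:R^-1) ≡
  - 2 * (harmonic (p %/ N) + P / N%:R * harmonic2 (p %/ N))
    - 2 / N%:R * (P * harmonic2 (p %/ N)) [p ^ 2].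
Proof.
move=> N_gt2 cpN pN; have N0 : N%:R != 0 :> rat by rewrite pnatr_eq0; lia.
have t_int : - N%:R^-1 \is a Zloc p by apply/ZlocN/Zloc_inv.
have lenm : (p %/ N <= m)%N.
  by apply: leq_trans (leq_div2l p (_ : 0 < 2)%N (ltnW N_gt2)) _ => //; rewrite divn2; lia.
have -> : binsum m (- N%:R^-1) = binsum m ((p %/ N)%:R + P * - N%:R^-1).
  have eq_p : P = (p %/ N)%:R * N%:R + (p %% N)%:R by rewrite -natrM -natrD -divn_eq.
  case: pN => pN; rewrite pN in eq_p.
    by congr (binsum _ _); rewrite eq_p; field.
  have -> : (p %/ N)%:R + P * - N%:R^-1 = - 1 - (- N%:R^-1).
    by rewrite eq_p -subn1 natrB; [field | lia].
  by apply: eq_bigr => k _; rewrite binprod_sym.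
(* With $t=-1/N$, half of the term $4ptH^{(2)}$ completes the combination known through Fermat
   quotients; the other half is left over. *)
apply: congr_trans (binsum_congr p_pr p_gt3 t_int lenm) _.
by apply: congr_eq; field.
Qed.

Lemma p_eqmod_congr x y : y \is a Zloc p -> x ≡ y [p ^ 2] -> p_eqmod p (p ^ 2) x y.
Proof.
move=> y_int xy; split; [exact: congr_Zloc xy | exact: y_int |].
exists ((x - y) / P ^+ 2); first exact: xy.
by rewrite natrX; field; rewrite p_neq0.
Qed.

End Assembly.

Theorem theorem2p2 (p : nat) (p_prime : prime p) (p_gt3 : (3 < p)%N) :
  [/\ p_eqmod p (p ^ 2)%N
        (\sum_(1 <= k < ((p - 1)%N./2).+1)
           ('C(2 * k, k) * 'C(4 * k, 2 * k))%N%:R / (k%:R * 64 ^+ k))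
        (6 * fermat_quotient p 2
         - p%:R * (3 * fermat_quotient p 2 ^+ 2
                   + 2 * (-1) ^+ ((p - 1)%N./2) * (euler_number (p - 3)%N)%:~R)),
      p_eqmod p (p ^ 2)%N
        (\sum_(1 <= k < ((p - 1)%N./2).+1)
           ('C(2 * k, k) * 'C(3 * k, k))%N%:R / (k%:R * 27 ^+ k))
        (3 * fermat_quotient p 3
         - p%:R * (3 / 2 * fermat_quotient p 3 ^+ 2
                   + 2 * legendre3 p * (U_number (p - 3)%N)%:~R))
    & p_eqmod p (p ^ 2)%N
        (\sum_(1 <= k < ((p - 1)%N./2).+1)
           ('C(3 * k, k) * 'C(6 * k, 3 * k))%N%:R / (k%:R * 432 ^+ k))
        (4 * fermat_quotient p 2 + 3 * fermat_quotient p 3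
         - p%:R * (2 * fermat_quotient p 2 ^+ 2
                   + 3 / 2 * fermat_quotient p 3 ^+ 2
                   + 5 * legendre3 p * (U_number (p - 3)%N)%:~R))].
Proof.
have p_odd := odd_prime_gt3 p_prime p_gt3.
have p_mod3 : (p %% 3 = 1 \/ p %% 3 = 2)%N.
  by have := prime_gt3_mod3 p_prime p_gt3; lia.
have p_mod4 : (p %% 4 = 1 \/ p %% 4 = 3)%N by lia.
have p_mod6 : (p %% 6 = 1 \/ p %% 6 = 5)%N by lia.
have cp2 := coprime_2 p_prime p_gt3; have cp3 := coprime_3 p_prime p_gt3.
have q2_int := Zloc_fermat_quotient p_prime p_gt3 cp2.
have q3_int := Zloc_fermat_quotient p_prime p_gt3 cp3.
have i2 := Zloc_inv cp2; have i3 := Zloc_inv cp3.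
have chi_int : legendre3 p \is a Zloc p.
  by rewrite /legendre3; case: ifP => _; [|case: ifP => _]; zloc.
have E_mod := euler_number_harmonic2 p_prime p_gt3.
have U_mod := U_number_harmonic2 p_prime p_gt3.
have sixth_mod := harmonic2_sixth p_prime p_gt3.
rewrite subn1; split; apply: p_eqmod_congr => //; try by zloc.
- have sum_mod := binsum_unit_fraction p_prime p_gt3 (N := 4) isT (coprime_4 p_prime p_gt3) p_mod4.
  rewrite (eq_bigr (fun k => binprod (- 4^-1) k / k%:R)) -/(binsum _ _) => [|k _]; last first.
    by rewrite -binprod_quarter -mulrA -invfM [(_ * k%:R)%R]mulrC.
  have /(congrS p_prime)/(congrZ i2) {}E_mod := E_mod.
  have h_mod := congrZ (Zloc_nat p 2) (harmonic_quarter p_prime p_gt3).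
  (* The main part is $-2(-3)$ times the logarithm for 2, that is $6q-3pq^2$ with $q=q_p(2)$; the
     leftover $-\frac p2H^{(2)}_{[p/4]}$ gives the Euler number term. *)
  by apply: congr_sub (congrB sum_mod (congrD h_mod E_mod)) _; rewrite /plog; field.
- have sum_mod := binsum_unit_fraction p_prime p_gt3 (N := 3) isT cp3 p_mod3.
  rewrite (eq_bigr (fun k => binprod (- 3^-1) k / k%:R)) -/(binsum _ _) => [|k _]; last first.
    by rewrite -binprod_third -mulrA -invfM [(_ * k%:R)%R]mulrC.
  have c_int : 2 * 3^-1 \is a Zloc p by zloc.
  have /(congrS p_prime)/(congrZ c_int) {}U_mod := U_mod.
  have h_mod := congrZ (Zloc_nat p 2) (harmonic_third p_prime p_gt3).
  by apply: congr_sub (congrB sum_mod (congrD h_mod U_mod)) _; rewrite /plog; field.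
- have sum_mod := binsum_unit_fraction p_prime p_gt3 (N := 6) isT (coprime_6 p_prime p_gt3) p_mod6.
  rewrite (eq_bigr (fun k => binprod (- 6^-1) k / k%:R)) -/(binsum _ _) => [|k _]; last first.
    by rewrite -binprod_sixth -mulrA -invfM [(_ * k%:R)%R]mulrC.
  (* The coefficient 5 of the third congruence arises here: $\frac p3H^{(2)}_{[p/6]}$ is $\frac
     p3\cdot5\cdot3$ times the Legendre symbol and $U_{p-3}$. *)
  have {}U_mod := congr_trans sixth_mod (congrZ (Zloc_nat p 5) U_mod).
  have /(congrS p_prime)/(congrZ i3) {}U_mod := U_mod.
  have h_mod := congrZ (Zloc_nat p 2) (harmonic_sixth p_prime p_gt3).
  by apply: congr_sub (congrB sum_mod (congrD h_mod U_mod)) _; rewrite /plog; field.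
Qed.
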